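(* Let $N\in\mathcal{LC}$ be nonquasianalytic and such that condition $(\gamma_1)$ fails for $N$. Let $\mathcal{M}$ be the set of all $M\in\mathcal{N}_{\preceq,R}$ with $\mathcal{B}(\mathcal{D}_{\{N\}}([-1,1]))\supseteq\Lambda_{\{M\}}$. Then for any $M\in\mathcal{M}$ the inclusion $\mathcal{B}(\mathcal{D}_{\{N\}}([-1,1]))\supseteq\Lambda_{\{M\}}$ is strict; more precisely, the set $$\mathcal{B}(\mathcal{D}_{\{N\}}([-1,1]))\setminus\bigcup_{M\in\mathcal{M}}\Lambda_{\{M\}}$$ is lineable in $\mathcal{B}(\mathcal{D}_{\{N\}}([-1,1]))$ (with a vector space of dimension $\aleph_0$ contained in the union of this set with $\{0\}$).
   Context: $\mathbb{N}=\{0,1,2,\dots\}$. $\mathcal{LC}$ is the set of sequences $N\in\mathbb{R}_{>0}^{\mathbb{N}}$ that are normalized ($1=N_0\le N_1$), log-convex ($N_j^2\le N_{j-1}N_{j+1}$ for $j\ge1$) and satisfy $\lim_{j\to\infty}(N_j)^{1/j}=+\infty$. Put $\nu_j:=N_j/N_{j-1}$ for $j\ge1$, $\nu_0:=1$. $N$ is nonquasianalytic if $\sum_{p\ge1}1/\nu_p<+\infty$. $N$ satisfies $(\gamma_1)$ if $\sup_{j\ge1}\frac{\nu_j}{j}\sum_{k\ge j}\frac1{\nu_k}<+\infty$. $M\preceq N$ means $\sup_{j\ge1}(M_j/N_j)^{1/j}<+\infty$. For the fixed $N$: $\mathcal{N}_{\preceq,R}:=\{M\in\mathbb{R}_{>0}^{\mathbb{N}}:\liminf_{p\to\infty}(M_p/p!)^{1/p}>0,\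 M\preceq N\}$. For $M\in\mathbb{R}_{>0}^{\mathbb{N}}$: $\Lambda_{\{M\}}:=\{(a_p)_p\in\mathbb{C}^{\mathbb{N}}:\exists\,h>0:\ \sup_p |a_p|/(h^pM_p)<+\infty\}$. $\mathcal{D}_{\{M\}}([-1,1])$ is the space of $f\in C^\infty(\mathbb{R},\mathbb{C})$ with $\operatorname{supp} f\subseteq[-1,1]$ such that $\sup_{p\in\mathbb{N},x\in\mathbb{R}}|f^{(p)}(x)|/(h^pM_p)<+\infty$ for some $h>0$. The Borel map is $\mathcal{B}(f):=(f^{(p)}(0))_{p\in\mathbb{N}}$. A subset $\mathcal{L}$ of a vector space $V$ is called lineable in $V$ if $\mathcal{L}\cup\{0\}$ contains an infinite-dimensional vector space. *)

(* Defs.v *)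
From Stdlib Require Import Reals Factorial Ensembles.
From Coquelicot Require Import Coquelicot.
Open Scope R_scope.

Definition pos_seq (M : nat -> R) : Prop := forall p, 0 < M p.

(** The [j]-th root of a positive [x], for [j >= 1]; the value at [j = 0] is
    irrelevant to every use below. *)
Definition nroot (j : nat) (x : R) : R := Rpower x (/ INR j).

Definition LC (N : nat -> R) : Prop :=
  pos_seq N /\
  (N 0%nat = 1 /\ N 0%nat <= N 1%nat) /\
  (forall j, (1 <= j)%nat -> N j ^ 2 <= N (j - 1)%nat * N (j + 1)%nat) /\
  is_lim_seq (fun j => nroot j (N j)) p_infty.

Definition quot (N : nat -> R) (j : nat) : R :=
  match j with
  | O => 1
  | S k => N (S k) / N k
  end.

Definition nonquasianalytic (N : nat -> R) : Prop :=
  ex_series (fun p => / quot N (S p)).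

(** [Series] is only meaningful on convergent series, so finiteness of the
    tails is part of the condition. *)
Definition gamma1 (N : nat -> R) : Prop :=
  ex_series (fun p => / quot N (S p)) /\
  exists C : R, forall j, (1 <= j)%nat ->
    quot N j / INR j * Series (fun k => / quot N (j + k)) <= C.

Definition preceq (M N : nat -> R) : Prop :=
  exists C : R, forall j, (1 <= j)%nat -> nroot j (M j / N j) <= C.

Definition N_preceq_R (N : nat -> R) : Ensemble (nat -> R) :=
  fun M =>
    pos_seq M /\
    Rbar_lt 0 (LimInf_seq (fun p => nroot p (M p / INR (fact p)))) /\
    preceq M N.

Definition Lambda (M : nat -> R) : Ensemble (nat -> C) :=
  fun a => exists h : R, 0 < h /\
    exists K : R, forall p, Cmod (a p) / (h ^ p * M p) <= K.

Definition smooth (f : R -> C) : Prop :=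
  forall n x, ex_derive_n (fun t => Re (f t)) n x /\
              ex_derive_n (fun t => Im (f t)) n x.

Definition CDerive_n (f : R -> C) (n : nat) (x : R) : C :=
  (Derive_n (fun t => Re (f t)) n x, Derive_n (fun t => Im (f t)) n x).

Definition supp (f : R -> C) : R -> Prop := adherence (fun x => f x <> RtoC 0).

(** The space D_{M}([-1,1]). *)
Definition Dspace (M : nat -> R) : Ensemble (R -> C) :=
  fun f =>
    smooth f /\
    included (supp f) (fun x => -1 <= x <= 1) /\
    exists h : R, 0 < h /\
      exists K : R, forall p x, Cmod (CDerive_n f p x) / (h ^ p * M p) <= K.

Definition Borel (f : R -> C) : nat -> C := fun p => CDerive_n f p 0.

Definition Borel_image (X : Ensemble (R -> C)) : Ensemble (nat -> C) :=
  fun a => exists f, X f /\ Borel f = a.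

(** The set of weight sequences M of the statement. *)
Definition calM (N : nat -> R) : Ensemble (nat -> R) :=
  fun M => N_preceq_R N M /\ Included _ (Lambda M) (Borel_image (Dspace N)).

(** Complex linear algebra in the vector space of sequences [nat -> C]. *)

Definition zero_seq : nat -> C := fun _ => RtoC 0.

Definition subspace (W : Ensemble (nat -> C)) : Prop :=
  W zero_seq /\
  (forall a b, W a -> W b -> W (fun p => Cplus (a p) (b p))) /\
  (forall (c : C) a, W a -> W (fun p => Cmult c (a p))).

(** [sum_n] sums over [0..n]: this is [c 0 * e 0 + ... + c n * e n]. *)
Definition lincomb (e : nat -> nat -> C) (c : nat -> C) (n : nat) : nat -> C :=
  fun p => sum_n (fun k => Cmult (c k) (e k p)) n.

Definition finite_dim (W : Ensemble (nat -> C)) : Prop :=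
  exists (n : nat) (e : nat -> nat -> C),
    (forall k, (k <= n)%nat -> W (e k)) /\
    (forall a, W a -> exists c, a = lincomb e c n).

(** Existence of a Hamel basis indexed by [nat]. *)
Definition dim_aleph0 (W : Ensemble (nat -> C)) : Prop :=
  exists e : nat -> nat -> C,
    (forall k, W (e k)) /\
    (forall n c, lincomb e c n = zero_seq ->
       forall k, (k <= n)%nat -> c k = RtoC 0) /\
    (forall a, W a -> exists n c, a = lincomb e c n).

Definition lineable_in (V L : Ensemble (nat -> C)) : Prop :=
  subspace V /\ Included _ L V /\
  exists W, subspace W /\ ~ finite_dim W /\
            Included _ W (Union _ L (Singleton _ zero_seq)).

(* Main.v *)
Require Import Defs.
From Stdlib Require Import Reals Ensembles.
From Coquelicot Require Import Coquelicot.
From Stdlib Require Import Ranalysis5 Rtopology FunctionalExtensionality Compare_dec.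
From Stdlib Require Import Classical ClassicalEpsilon IndefiniteDescription.
From Stdlib Require Import Lra Lia Psatz.
Open Scope R_scope.

(** Write [V] for the Borel image of [D_{N}([-1,1])] and [nu] for [quot N].

    There is a function in [D_{N}([-1,1])] whose derivatives at the origin are as
    large as the class permits, [|f^(p)(0)| >= N_p / 2] for all [p]. It is the
    product of two functions. The first is the superposition [theta] of waves of
    frequency [2 nu_j] and amplitude [N_j / (2 nu_j)^j], whose derivatives at the
    origin add up without cancellation. The second is a bump, equal to [1] near
    the origin, obtained from a trapezoid by averaging over windows of size
    proportional to [1 / nu_k]; this sequence is summable by nonquasianalyticity
    ([flat_bump], [theta_large], [large_compact]).

    The dilates [f((k+1)x)] belong to the same space, and their Borel images are
    [(k+1)^p f^(p)(0)]. In a nontrivial linear combination the largest dilation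
    dominates, so the combination is at least [delta N_p] in modulus for all large
    [p] ([dilates_lower]). Hence the dilates are linearly independent, and it
    remains to see that no sequence [b] of this size lies in a [Lambda_{M}]
    contained in [V] ([large_not_in_Lambda]).

    If it did, then [N_p <= const h^p M_p] for large [p], and every sequence
    dominated by [N] and vanishing at small indices would be a Borel image. The one
    used equals [N_p] at [p = 2q], where [q] runs through a very sparse set of
    indices at which the failure of [gamma1] is felt, and [0] elsewhere. Let [F] be
    a function realizing it. At such a [q] its derivative of order [2q] equals
    [N_(2q)] at the origin and is otherwise flat there to a very high order.
    Bang's quantitative form of the Denjoy-Carleman theorem ([bang_estimate]) keeps
    it above [N_(2q) / 2] on an interval whose length is comparable to the sum of
    [1 / nu_k] for [k] from a multiple of [q] up to twice the next chosen index,
    and the sum over larger [k] is negligible by sparsity. Integrating [q] times, and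
    comparing with the class bound on the derivative of order [q], shows that this
    length is at most a constant times [q / nu_q] ([gap_estimate]). The constant
    depends on [F] only, so that the quantity in [gamma1] stays bounded along the
    chosen indices, which is a contradiction. *)

(** * Smooth functions as chains of derivatives *)

(** A smooth function is handled together with its derivatives: [F p] is the
    [p]-th derivative of [F 0]. Existence and value of all iterated derivatives
    then come for free. *)
Definition chain (F : nat -> R -> R) : Prop :=
  forall p x, is_derive (F p) x (F (S p) x).

Lemma chain_shift F k : chain F -> chain (fun p => F (k + p)%nat).
Proof. intros H p x. rewrite <- plus_n_Sm. apply H. Qed.

Lemma chain_Derive_n F : chain F -> forall p x, Derive_n (F 0%nat) p x = F p x.
Proof.
  intros H p; induction p as [|p IH]; intros x; [reflexivity|].
  simpl. rewrite (Derive_ext _ _ _ IH). apply is_derive_unique, H.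
Qed.

Lemma chain_ex_derive_n F :
  chain F -> forall p x, ex_derive_n (F 0%nat) p x.
Proof.
  intros H [|p] x; [exact I|].
  simpl. apply ex_derive_ext with (F p).
  - intros t. symmetry. now apply chain_Derive_n.
  - eexists. apply H.
Qed.

Lemma chain_of_smooth f :
  (forall n x, ex_derive_n f n x) -> chain (Derive_n f).
Proof. intros H p x. apply Derive_correct, (H (S p) x). Qed.

Lemma chain_comp_scal F l :
  chain F -> chain (fun p x => l ^ p * F p (l * x)).
Proof.
  intros H p x.
  pose proof (H p (l * x)) as H1.
  evar_last.
  - apply (is_derive_scal (fun x => F p (l * x)) x (l ^ p)).
    apply (is_derive_comp (F p) (fun x => l * x)); [exact H1|].
    apply (is_derive_scal (fun x => x)), is_derive_id.
  - unfold scal; simpl; unfold mult, one; simpl; ring.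
Qed.

Lemma chain_lin F G a b :
  chain F -> chain G -> chain (fun p x => a * F p x + b * G p x).
Proof.
  intros HF HG p x.
  apply (is_derive_plus (fun x => a * F p x) (fun x => b * G p x)).
  - apply (is_derive_scal (F p)), HF.
  - apply (is_derive_scal (G p)), HG.
Qed.

(** Limits may be differentiated when the derivatives converge uniformly. All
    the smooth functions below are limits of this kind. *)
Lemma is_derive_uniform_limit (u u' : nat -> R -> R) (f g : R -> R) (eps : nat -> R) :
  (forall n x, is_derive (u n) x (u' n x)) ->
  (forall n x, continuity_pt (u' n) x) ->
  (forall x, is_lim_seq (fun n => u n x) (f x)) ->
  (forall n x, Rabs (u' n x - g x) <= eps n) ->
  is_lim_seq eps 0 ->
  forall x, is_derive f x (g x).
Proof.
  intros Hd Hc Hl Hu He x.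
  assert (HC : CVU u' g x (mkposreal 1 Rlt_0_1)).
  { intros e He0.
    apply is_lim_seq_spec in He. destruct (He (mkposreal e He0)) as [n0 Hn0].
    exists n0; intros n y Hn _.
    rewrite Rabs_minus_sym. apply Rle_lt_trans with (1 := Hu n y).
    specialize (Hn0 n Hn); simpl in Hn0. rewrite Rminus_0_r in Hn0.
    apply Rle_lt_trans with (2 := Hn0), Rle_abs. }
  assert (Hx : Boule x (mkposreal 1 Rlt_0_1) x).
  { unfold Boule; simpl. rewrite Rminus_diag, Rabs_R0. lra. }
  apply is_derive_Reals.
  apply (derivable_pt_lim_CVU u u' f g x x (mkposreal 1 Rlt_0_1) Hx).
  - intros y n _. apply is_derive_Reals, Hd.
  - intros y _. apply is_lim_seq_Reals, Hl.
  - exact HC.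
  - apply (CVU_continuity u' g x _ HC). intros n y _; apply Hc.
Qed.

(** * Tails of convergent series *)

Definition tail (a : nat -> R) (q : nat) : R := Series (fun k => a (q + k)%nat).

Lemma tail_step a q : ex_series a -> tail a q = a q + tail a (S q).
Proof.
  intros H. unfold tail. rewrite Series_incr_1.
  - rewrite Nat.add_0_r. f_equal. apply Series_ext. intros n. f_equal. lia.
  - apply (ex_series_incr_n a q), H.
Qed.

Lemma tail_nonneg a q : ex_series a -> (forall k, 0 <= a k) -> 0 <= tail a q.
Proof.
  intros H Ha. unfold tail.
  replace 0 with (Series (fun _ => 0 * 0)) by (rewrite Series_scal_l; ring).
  apply Series_le.
  - intros n; rewrite Rmult_0_l; split; [lra|apply Ha].
  - apply (ex_series_incr_n a q), H.
Qed.

Lemma tail_le a p q : ex_series a -> (forall k, 0 <= a k) -> (p <= q)%nat ->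
  tail a q <= tail a p.
Proof.
  intros H Ha Hpq. induction Hpq as [|q _ IH]; [lra|].
  rewrite (tail_step a q H) in IH. specialize (Ha q). lra.
Qed.

Lemma term_le_series a p : ex_series a -> (forall k, 0 <= a k) -> a p <= Series a.
Proof.
  intros H Ha. apply Rle_trans with (2 := tail_le a 0 p H Ha (Nat.le_0_l p)).
  rewrite (tail_step a p H). pose proof (tail_nonneg a (S p) H Ha). lra.
Qed.

Lemma tail_sum a q : ex_series a -> tail a (S q) = Series a - sum_n a q.
Proof.
  intros H. induction q as [|q IH].
  - rewrite sum_O. pose proof (tail_step a 0 H) as E.
    change (tail a 0) with (Series a) in E. lra.
  - pose proof (tail_step a (S q) H) as E. rewrite sum_Sn. unfold plus; simpl. lra.
Qed.

Lemma tail_lim a : ex_series a -> is_lim_seq (tail a) 0.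
Proof.
  intros H. apply is_lim_seq_incr_1.
  apply is_lim_seq_ext with (fun q => Series a - sum_n a q).
  - intros q. now rewrite tail_sum.
  - replace 0 with (Series a - Series a) by ring.
    apply is_lim_seq_minus'; [apply is_lim_seq_const|].
    exact (Series_correct a H).
Qed.

Lemma series_remainder (u c : nat -> R) n :
  (forall j, Rabs (u j) <= c j) -> ex_series c ->
  Rabs (sum_n u n - Series u) <= tail c (S n).
Proof.
  intros Hu Hc.
  assert (Hau : ex_series (fun j => Rabs (u j))).
  { apply (ex_series_le (V := R_CompleteNormedModule) _ c); [|exact Hc].
    intros j. unfold norm; simpl; unfold abs; simpl. rewrite Rabs_Rabsolu. apply Hu. }
  pose proof (ex_series_Rabs u Hau) as Hxu.
  replace (sum_n u n - Series u) with (- tail u (S n))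
    by (rewrite tail_sum by exact Hxu; apply Ropp_minus_distr).
  rewrite Rabs_Ropp. unfold tail.
  apply Rle_trans with (Series (fun k => Rabs (u (S n + k)%nat))).
  - apply Series_Rabs, (ex_series_incr_n (fun j => Rabs (u j)) (S n)), Hau.
  - apply Series_le.
    + intros k; split; [apply Rabs_pos|apply Hu].
    + apply (ex_series_incr_n c (S n)), Hc.
Qed.

(** * Averaging *)

Definition lip (L : R) (f : R -> R) : Prop :=
  forall x y, Rabs (f x - f y) <= L * Rabs (x - y).

Definition diffq (a : R) (f : R -> R) (x : R) : R :=
  (f (x + a) - f (x - a)) / (2 * a).

(** Convolution with the normalized indicator of [[-a,a]]. Its derivative is the
    difference quotient [diffq a f], so every averaging gains one derivative at
    the cost of a factor [1/a]. *)
Definition average (a : R) (f : R -> R) (x : R) : R :=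
  RInt f (x - a) (x + a) / (2 * a).

Lemma lip_continuous L f : lip L f -> forall x, continuity_pt f x.
Proof.
  intros H x e He.
  assert (HL : 0 <= L).
  { specialize (H 1 0). rewrite Rminus_0_r, Rabs_R1 in H.
    pose proof (Rabs_pos (f 1 - f 0)). lra. }
  exists (e / (L + 1)). split.
  { apply Rdiv_lt_0_compat; lra. }
  intros y [_ Hy]. simpl in *. unfold Rdist in *.
  apply Rle_lt_trans with (1 := H y x).
  apply Rle_lt_trans with ((L + 1) * Rabs (y - x)).
  - pose proof (Rabs_pos (y - x)); nra.
  - apply Rmult_lt_reg_r with (/ (L + 1)); [apply Rinv_0_lt_compat; lra|].
    replace ((L + 1) * Rabs (y - x) * / (L + 1)) with (Rabs (y - x)) by (field; lra).
    exact Hy.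
Qed.

Lemma lip_of_derive_bound f f' L :
  (forall x, is_derive f x (f' x)) -> (forall x, Rabs (f' x) <= L) -> lip L f.
Proof.
  intros Hd Hb x y.
  destruct (MVT_gen f y x f') as [c [_ Hc]].
  - intros; apply Hd.
  - intros t _. apply continuity_pt_filterlim, (ex_derive_continuous f t).
    eexists; apply Hd.
  - rewrite Hc, Rabs_mult. apply Rmult_le_compat_r; [apply Rabs_pos|apply Hb].
Qed.

Lemma average_derive a f : 0 < a -> (forall x, continuity_pt f x) ->
  forall x, is_derive (average a f) x (diffq a f x).
Proof.
  intros Ha Hc x.
  assert (Hc' : forall t, continuous f t)
    by (intros t; apply continuity_pt_filterlim, Hc).
  assert (Hex : forall u v, ex_RInt f u v)
    by (intros u v; apply (ex_RInt_continuous (V := R_CompleteNormedModule));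
      intros; apply Hc').
  assert (HP : forall t, is_derive (fun t => RInt f 0 t) t (f t)).
  { intros t. apply (is_derive_RInt f (RInt f 0) 0 t); [|apply Hc'].
    apply filter_forall. intros b. apply (RInt_correct (V := R_CompleteNormedModule)), Hex. }
  apply is_derive_ext with (fun t => / (2 * a) * (RInt f 0 (t + a) - RInt f 0 (t - a))).
  { intros t. unfold average.
    rewrite <- (RInt_Chasles f 0 (t - a) (t + a) (Hex _ _) (Hex _ _)).
    unfold plus; simpl. field. lra. }
  evar_last.
  - apply is_derive_scal.
    apply (is_derive_minus (fun t => RInt f 0 (t + a)) (fun t => RInt f 0 (t - a))).
    + apply (is_derive_comp (fun t => RInt f 0 t) (fun t => t + a)); [apply HP|].
      auto_derive; [exact I|reflexivity].
    + apply (is_derive_comp (fun t => RInt f 0 t) (fun t => t - a)); [apply HP|].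
      auto_derive; [exact I|reflexivity].
  - unfold diffq, minus, plus, opp, scal; simpl; unfold mult; simpl. field. lra.
Qed.

(** Compared with [average_derive]: averaging and differentiating commute. *)
Lemma average_of_derive a f f' : 0 < a ->
  (forall x, is_derive f x (f' x)) -> (forall x, continuity_pt f' x) ->
  forall x, average a f' x = diffq a f x.
Proof.
  intros Ha Hd Hc x. unfold average, diffq. f_equal.
  apply (is_RInt_unique f' (x - a) (x + a)).
  apply (is_RInt_derive f f').
  - intros; apply Hd.
  - intros t _; apply continuity_pt_filterlim, Hc.
Qed.

(** Every estimate on averages is read off from this: an average is a value
    taken in the window. *)
Lemma average_mean a f : 0 < a -> (forall x, continuity_pt f x) ->
  forall x, exists c, Rabs (c - x) <= a /\ average a f x = f c.
Proof.
  intros Ha Hc x.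
  assert (Hc' : forall t, continuous f t)
    by (intros t; apply continuity_pt_filterlim, Hc).
  assert (HP : forall t, is_derive (fun t => RInt f (x - a) t) t (f t)).
  { intros t. apply (is_derive_RInt f (RInt f (x - a)) (x - a) t); [|apply Hc'].
    apply filter_forall. intros b. apply (RInt_correct (V := R_CompleteNormedModule)).
    apply (ex_RInt_continuous (V := R_CompleteNormedModule)); intros; apply Hc'. }
  destruct (MVT_gen (fun t => RInt f (x - a) t) (x - a) (x + a) f) as [c [Hcc Heq]].
  - intros; apply HP.
  - intros t _. apply continuity_pt_filterlim.
    apply (ex_derive_continuous (fun t => RInt f (x - a) t) t). eexists; apply HP.
  - exists c. rewrite Rmin_left, Rmax_right in Hcc by lra. split.
    + apply Rabs_le; lra.
    + unfold average. rewrite RInt_point in Heq. unfold zero in Heq; simpl in Heq.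
      rewrite Rminus_0_r in Heq. rewrite Heq. field. lra.
Qed.

Lemma average_lip a f L : 0 < a -> lip L f -> lip L (average a f).
Proof.
  intros Ha HL.
  apply lip_of_derive_bound with (diffq a f).
  - apply average_derive; [exact Ha|]. now apply lip_continuous with L.
  - intros x. unfold diffq, Rdiv. rewrite Rabs_mult, (Rabs_right (/ (2 * a))).
    + apply Rmult_le_reg_r with (2 * a); [lra|].
      rewrite Rmult_assoc, Rinv_l, Rmult_1_r by lra.
      apply Rle_trans with (1 := HL _ _).
      replace (x + a - (x - a)) with (2 * a) by ring. rewrite Rabs_right; lra.
    + apply Rle_ge, Rlt_le, Rinv_0_lt_compat; lra.
Qed.

Lemma diffq_bound a f B : 0 < a -> (forall x, Rabs (f x) <= B) ->
  forall x, Rabs (diffq a f x) <= / a * B.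
Proof.
  intros Ha HB x. unfold diffq, Rdiv.
  rewrite Rabs_mult, (Rabs_right (/ (2 * a)))
    by (apply Rle_ge, Rlt_le, Rinv_0_lt_compat; lra).
  replace (/ a * B) with ((B + B) * / (2 * a)) by (field; lra).
  apply Rmult_le_compat_r; [apply Rlt_le, Rinv_0_lt_compat; lra|].
  unfold Rminus. apply Rle_trans with (1 := Rabs_triang _ _).
  rewrite Rabs_Ropp. apply Rplus_le_compat; apply HB.
Qed.

Lemma diffq_lip a f L : 0 < a -> lip L f -> lip (/ a * L) (diffq a f).
Proof.
  intros Ha HL x y.
  replace (diffq a f x - diffq a f y)
    with (((f (x + a) - f (y + a)) + - (f (x - a) - f (y - a))) * / (2 * a))
    by (unfold diffq; field; lra).
  rewrite Rabs_mult, (Rabs_right (/ (2 * a)))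
    by (apply Rle_ge, Rlt_le, Rinv_0_lt_compat; lra).
  replace (/ a * L * Rabs (x - y))
    with ((L * Rabs (x - y) + L * Rabs (x - y)) * / (2 * a)) by (field; lra).
  apply Rmult_le_compat_r; [apply Rlt_le, Rinv_0_lt_compat; lra|].
  apply Rle_trans with (1 := Rabs_triang _ _). rewrite Rabs_Ropp.
  pose proof (HL (x + a) (y + a)). pose proof (HL (x - a) (y - a)).
  replace (x + a - (y + a)) with (x - y) in * by ring.
  replace (x - a - (y - a)) with (x - y) in * by ring. lra.
Qed.

(** Being constant on a ball survives averaging on a smaller ball. Being flat at
    the origin and vanishing far away are both of this form. *)
Definition const_near (c x r : R) (f : R -> R) : Prop :=
  forall y, Rabs (y - x) <= r -> f y = c.

Lemma average_const_near a f c x r : 0 < a -> (forall y, continuity_pt f y) ->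
  const_near c x r f -> const_near c x (r - a) (average a f).
Proof.
  intros Ha Hc H y Hy.
  destruct (average_mean a f Ha Hc y) as [d [Hd ->]].
  apply H. replace (d - x) with ((d - y) + (y - x)) by ring.
  apply Rle_trans with (1 := Rabs_triang _ _). lra.
Qed.

Lemma diffq_const_near a f c x r : 0 < a ->
  const_near c x r f -> const_near 0 x (r - a) (diffq a f).
Proof.
  intros Ha H y Hy. unfold diffq. rewrite !H; [field; lra| |];
  apply Rabs_le_between in Hy; apply Rabs_le; lra.
Qed.

(** * Flat bumps by infinitely many averagings *)

Section Bump.

Variables (a : nat -> R) (tau : R -> R) (L : R).
Hypotheses (ha : forall k, 0 < a k) (hsum : ex_series a)
  (hL : lip L tau) (htau : forall x, Rabs (tau x) <= 1).

(** The bound on the [p]-th derivative: one factor [1/a] per derivative. *)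
Fixpoint invprod (p : nat) : R :=
  match p with O => 1 | S q => / a q * invprod q end.

Fixpoint quotients (p : nat) : R -> R :=
  match p with O => tau | S q => diffq (a q) (quotients q) end.

(** The [p]-th derivative of the function obtained from [tau] after [p + n]
    averagings: the first [p] windows differentiate, the others only smooth. *)
Fixpoint smoothed (p n : nat) : R -> R :=
  match n with
  | O => quotients p
  | S m => average (a (p + m)) (smoothed p m)
  end.

Lemma quotients_lip p : lip (L * invprod p) (quotients p).
Proof.
  induction p as [|p IH]; simpl.
  - now rewrite Rmult_1_r.
  - replace (L * (/ a p * invprod p)) with (/ a p * (L * invprod p)) by ring.
    now apply diffq_lip.
Qed.

Lemma smoothed_lip p n : lip (L * invprod p) (smoothed p n).
Proof.
  induction n as [|n IH]; simpl; [apply quotients_lip|]. now apply average_lip.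
Qed.

Lemma smoothed_continuous p n x : continuity_pt (smoothed p n) x.
Proof. apply lip_continuous with (1 := smoothed_lip p n). Qed.

Lemma smoothed_bound p n x : Rabs (smoothed p n x) <= invprod p.
Proof.
  revert x; induction n as [|n IH]; intros x; simpl.
  - revert x; induction p as [|p IH]; intros x; simpl; [apply htau|].
    now apply diffq_bound.
  - destruct (average_mean (a (p + n)) (smoothed p n) (ha _)
      (smoothed_continuous p n) x) as [c [_ ->]]. apply IH.
Qed.

Lemma smoothed_derive p n x :
  is_derive (smoothed p (S n)) x (smoothed (S p) n x).
Proof.
  revert x; induction n as [|n IH]; intros x.
  - simpl. rewrite Nat.add_0_r. apply average_derive; [apply ha|].
    exact (smoothed_continuous p 0).
  - change (smoothed p (S (S n))) with (average (a (p + S n)) (smoothed p (S n))).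
    change (smoothed (S p) (S n) x)
      with (average (a (S p + n)) (smoothed (S p) n) x).
    rewrite (average_of_derive _ (smoothed p (S n))); [|apply ha|exact IH|].
    + replace (S p + n)%nat with (p + S n)%nat by lia.
      apply average_derive; [apply ha|]. apply smoothed_continuous.
    + apply smoothed_continuous.
Qed.

(** The last averaging moves the function by at most its window times its
    Lipschitz constant, so summable windows give uniform convergence. *)
Lemma smoothed_step p n x :
  Rabs (smoothed p (S n) x - smoothed p n x) <= L * invprod p * a (p + n).
Proof.
  simpl. destruct (average_mean (a (p + n)) (smoothed p n) (ha _)
      (smoothed_continuous p n) x) as [c [Hc ->]].
  apply Rle_trans with (1 := smoothed_lip p n c x).
  apply Rmult_le_compat_l; [|exact Hc].
  pose proof (quotients_lip p 1 0) as H.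
  rewrite Rminus_0_r, Rabs_R1, Rmult_1_r in H.
  apply Rle_trans with (2 := H), Rabs_pos.
Qed.

Lemma smoothed_tail p n m x :
  Rabs (smoothed p (n + m) x - smoothed p n x)
    <= L * invprod p * (tail a (p + n) - tail a (p + (n + m))).
Proof.
  induction m as [|m IH].
  - rewrite Nat.add_0_r, !Rminus_diag, Rabs_R0. lra.
  - replace (n + S m)%nat with (S (n + m)) by lia.
    replace (smoothed p (S (n + m)) x - smoothed p n x)
      with ((smoothed p (S (n + m)) x - smoothed p (n + m) x)
            + (smoothed p (n + m) x - smoothed p n x)) by ring.
    apply Rle_trans with (1 := Rabs_triang _ _).
    pose proof (smoothed_step p (n + m) x) as H.
    replace (p + S (n + m))%nat with (S (p + (n + m))) by lia.
    rewrite (tail_step a (p + (n + m)) hsum) in IH. lra.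
Qed.

Lemma smoothed_cauchy p n m x :
  Rabs (smoothed p (n + m) x - smoothed p n x) <= L * invprod p * tail a (p + n).
Proof.
  apply Rle_trans with (1 := smoothed_tail p n m x).
  apply Rmult_le_compat_l.
  - pose proof (quotients_lip p 1 0) as H.
    rewrite Rminus_0_r, Rabs_R1, Rmult_1_r in H.
    apply Rle_trans with (2 := H), Rabs_pos.
  - pose proof (tail_nonneg a (p + (n + m)) hsum (fun k => Rlt_le _ _ (ha k))). lra.
Qed.

Lemma smoothed_rate p : is_lim_seq (fun n => L * invprod p * tail a (p + n)) 0.
Proof.
  replace (Finite 0) with (Rbar_mult (L * invprod p) 0)
    by (simpl; now rewrite Rmult_0_r).
  apply is_lim_seq_scal_l.
  apply is_lim_seq_ext with (fun n => tail a (n + p)).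
  - intros n. now rewrite Nat.add_comm.
  - apply (is_lim_seq_incr_n (tail a) p), tail_lim, hsum.
Qed.

Definition bump (p : nat) (x : R) : R := real (Lim_seq (fun n => smoothed p n x)).

Lemma bump_lim p x : is_lim_seq (fun n => smoothed p n x) (bump p x).
Proof.
  apply Lim_seq_correct', ex_lim_seq_cauchy_corr.
  intros e.
  destruct (proj2 (is_lim_seq_spec _ _) (smoothed_rate p)
    (mkposreal (e / 2) (is_pos_div_2 e))) as [n0 H0].
  exists n0. intros n m Hn Hm.
  specialize (H0 n0 (le_n _)). simpl in H0. rewrite Rminus_0_r in H0.
  pose proof (Rle_abs (L * invprod p * tail a (p + n0))) as Hr.
  pose proof (smoothed_cauchy p n0 (n - n0) x) as Hcn.
  pose proof (smoothed_cauchy p n0 (m - n0) x) as Hcm.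
  replace (n0 + (n - n0))%nat with n in Hcn by lia.
  replace (n0 + (m - n0))%nat with m in Hcm by lia.
  replace (smoothed p n x - smoothed p m x)
    with ((smoothed p n x - smoothed p n0 x) + - (smoothed p m x - smoothed p n0 x))
    by ring.
  apply Rle_lt_trans with (1 := Rabs_triang _ _). rewrite Rabs_Ropp. lra.
Qed.

Lemma bump_close p n x :
  Rabs (smoothed p n x - bump p x) <= L * invprod p * tail a (p + n).
Proof.
  rewrite Rabs_minus_sym.
  assert (Hl : is_lim_seq (fun m => Rabs (smoothed p (m + n) x - smoothed p n x))
                 (Rabs (bump p x - smoothed p n x))).
  { apply (is_lim_seq_abs _ (bump p x - smoothed p n x)).
    apply is_lim_seq_minus'; [|apply is_lim_seq_const].
    apply (is_lim_seq_incr_n (fun m => smoothed p m x) n), bump_lim. }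
  apply (is_lim_seq_le _ (fun _ => L * invprod p * tail a (p + n)) _ _) with (2 := Hl)
    (3 := is_lim_seq_const _).
  intros m. rewrite (Nat.add_comm m n). apply smoothed_cauchy.
Qed.

Lemma bump_chain : chain bump.
Proof.
  intros p. apply (is_derive_uniform_limit
    (fun n => smoothed p (S n)) (fun n => smoothed (S p) n) _ _
    (fun n => L * invprod (S p) * tail a (S p + n))).
  - intros n x. apply smoothed_derive.
  - intros n x. apply smoothed_continuous.
  - intros x. apply (is_lim_seq_incr_1 (fun n => smoothed p n x)), bump_lim.
  - intros n x. apply bump_close.
  - apply smoothed_rate.
Qed.

Lemma bump_bound p x : Rabs (bump p x) <= invprod p.
Proof.
  apply (is_lim_seq_le (fun n => Rabs (smoothed p n x)) (fun _ => invprod p)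
    (Rabs (bump p x)) (invprod p)).
  - intros n; apply smoothed_bound.
  - apply (is_lim_seq_abs _ (bump p x)), bump_lim.
  - apply is_lim_seq_const.
Qed.

(** Each of the [p + n] operations shrinks the ball of constancy by its window;
    the sum of the windows used is a difference of tails. *)
Lemma smoothed_const_near c x r n :
  const_near c x r tau ->
  forall p, const_near (match p with O => c | _ => 0 end) x
         (r - tail a 0 + tail a (p + n)) (smoothed p n).
Proof.
  intros Hc p. induction n as [|n IH].
  - rewrite Nat.add_0_r. induction p as [|p IH]; simpl.
    + replace (r - tail a 0 + tail a 0) with r by ring. exact Hc.
    + replace (r - tail a 0 + tail a (S p))
        with (r - tail a 0 + tail a p - a p)
        by (rewrite (tail_step a p hsum); ring).
      eapply diffq_const_near; [apply ha|exact IH].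
  - simpl. rewrite <- plus_n_Sm.
    replace (r - tail a 0 + tail a (S (p + n)))
        with (r - tail a 0 + tail a (p + n) - a (p + n)%nat)
        by (rewrite (tail_step a (p + n) hsum); ring).
    apply average_const_near; [apply ha|apply smoothed_continuous|exact IH].
Qed.

Lemma bump_const c x r :
  const_near c x r tau -> Series a <= r ->
  forall p, bump p x = match p with O => c | _ => 0 end.
Proof.
  intros Hc Hr p.
  assert (H : forall n, smoothed p n x = match p with O => c | _ => 0 end).
  { intros n. apply (smoothed_const_near c x r n Hc p).
    rewrite Rminus_diag, Rabs_R0.
    pose proof (tail_nonneg a (p + n) hsum (fun k => Rlt_le _ _ (ha k))).
    change (tail a 0) with (Series a). lra. }
  unfold bump. rewrite (Lim_seq_ext _ (fun _ => match p with O => c | _ => 0 end) H).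
  now rewrite Lim_seq_const.
Qed.

End Bump.

(** * Log-convex weights *)

Lemma quot_pos N k : pos_seq N -> 0 < quot N k.
Proof.
  intros H. destruct k as [|k]; simpl; [lra|]. apply Rdiv_lt_0_compat; apply H.
Qed.

Lemma quot_step N k : pos_seq N -> N (S k) = quot N (S k) * N k.
Proof. intros H. simpl. field. apply Rgt_not_eq, H. Qed.

Lemma quot_incr N : LC N -> forall j k, (j <= k)%nat -> quot N j <= quot N k.
Proof.
  intros (Hp & (H0 & H1) & Hlc & _) j k Hjk.
  induction Hjk as [|k Hjk IH]; [lra|]. apply Rle_trans with (1 := IH).
  clear - Hp H0 H1 Hlc. destruct k as [|k].
  - simpl. apply Rmult_le_reg_r with (N 0%nat); [apply Hp|].
    unfold Rdiv. rewrite Rmult_assoc, Rinv_l by (apply Rgt_not_eq, Hp). lra.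
  - specialize (Hlc (S k) ltac:(lia)).
    replace (S k - 1)%nat with k in Hlc by lia.
    replace (S k + 1)%nat with (S (S k)) in Hlc by lia.
    simpl quot. pose proof (Hp k). pose proof (Hp (S k)).
    apply Rmult_le_reg_r with (N k * N (S k)); [nra|].
    replace (N (S k) / N k * (N k * N (S k))) with (N (S k) ^ 2) by (field; lra).
    replace (N (S (S k)) / N (S k) * (N k * N (S k))) with (N k * N (S (S k)))
      by (field; lra). exact Hlc.
Qed.

Lemma weight_supermult N : LC N -> forall i j, N i * N j <= N (i + j)%nat.
Proof.
  intros H i j. pose proof (proj1 H) as Hp.
  induction i as [|i IH].
  - rewrite (proj1 (proj1 (proj2 H))). simpl. lra.
  - change (S i + j)%nat with (S (i + j)).
    rewrite (quot_step N i Hp), (quot_step N (i + j) Hp), Rmult_assoc.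
    apply Rmult_le_compat; [apply Rlt_le, quot_pos, Hp| |
      apply quot_incr; [exact H|lia]|exact IH].
    apply Rlt_le, Rmult_lt_0_compat; apply Hp.
Qed.

Lemma weight_growth N : LC N -> forall j k,
  N j * quot N j ^ k <= N (j + k)%nat.
Proof.
  intros H j k. pose proof (proj1 H) as Hp.
  induction k as [|k IH]; [rewrite Nat.add_0_r; simpl; lra|].
  rewrite <- plus_n_Sm, (quot_step N (j + k) Hp). simpl pow.
  replace (N j * (quot N j * quot N j ^ k)) with (quot N j * (N j * quot N j ^ k)) by ring.
  apply Rmult_le_compat; [apply Rlt_le, quot_pos, Hp| |
      apply quot_incr; [exact H|lia]|exact IH].
  apply Rmult_le_pos; [apply Rlt_le, Hp|apply pow_le, Rlt_le, quot_pos, Hp].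
Qed.

Lemma weight_decay N : LC N -> forall p k,
  N (p + k)%nat <= N p * quot N (p + k) ^ k.
Proof.
  intros H p k. pose proof (proj1 H) as Hp.
  induction k as [|k IH]; [rewrite Nat.add_0_r; simpl; lra|].
  rewrite <- plus_n_Sm, (quot_step N (p + k) Hp), <- tech_pow_Rmult, (Rmult_comm (N p)).
  rewrite Rmult_assoc, (Rmult_comm _ (N p)).
  apply Rmult_le_compat_l; [apply Rlt_le, quot_pos, Hp|].
  apply Rle_trans with (1 := IH). apply Rmult_le_compat_l; [apply Rlt_le, Hp|].
  apply pow_incr. split; [apply Rlt_le, quot_pos, Hp|].
  apply quot_incr; [exact H|lia].
Qed.

(** The line of slope [ln (quot N j)] through [(j, ln N_j)] supports the convex
    graph of [ln N]; this is that inequality at [p], without logarithms. *)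
Lemma weight_tangent N : LC N -> forall j p,
  N j * quot N j ^ p <= N p * quot N j ^ j.
Proof.
  intros H j p. pose proof (proj1 H) as Hp.
  pose proof (quot_pos N j Hp) as Hq.
  destruct (Nat.le_ge_cases j p) as [Hjp|Hjp].
  - replace p with (j + (p - j))%nat at 1 by lia. rewrite pow_add.
    pose proof (weight_growth N H j (p - j)) as E.
    replace (j + (p - j))%nat with p in E by lia.
    pose proof (pow_le (quot N j) j (Rlt_le _ _ Hq)). nra.
  - pose proof (weight_decay N H p (j - p)) as E.
    replace (p + (j - p))%nat with j in E by lia.
    replace (quot N j ^ j) with (quot N j ^ (j - p) * quot N j ^ p)
      by (rewrite <- pow_add; f_equal; lia).
    pose proof (pow_le (quot N j) p (Rlt_le _ _ Hq)). nra.
Qed.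

(** * A flat bump of class N *)

(** Membership in the Roumieu class of [N], uniformly on the line. The
    normalizations [1 <= h] and [0 <= K] allow monotonicity in both
    constants. *)
Definition class_chain (N : nat -> R) (F : nat -> R -> R) : Prop :=
  chain F /\ exists h K, 1 <= h /\ 0 <= K /\
    forall p x, Rabs (F p x) <= K * (h ^ p * N p).

Definition trapezoid (x : R) : R := Rmax 0 (Rmin 1 (3 / 2 - 2 * Rabs x)).

(** Innermost comparisons first, so that nested maxima and minima are resolved. *)
Ltac case_le :=
  match goal with
  | |- context [Rle_dec ?a ?b] =>
      lazymatch a with context [Rle_dec _ _] => fail | _ =>
      lazymatch b with context [Rle_dec _ _] => fail | _ =>
      destruct (Rle_dec a b) end end
  end.

Lemma trapezoid_lip : lip 2 trapezoid.
Proof.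
  intros x y. unfold trapezoid.
  assert (H : Rabs (Rabs x - Rabs y) <= Rabs (x - y)) by apply Rabs_triang_inv2.
  set (u := Rabs x) in *. set (v := Rabs y) in *. set (d := Rabs (x - y)) in *.
  apply Rabs_le_between in H. apply Rabs_le.
  unfold Rmax, Rmin;
  repeat case_le; lra.
Qed.

Lemma trapezoid_bound x : Rabs (trapezoid x) <= 1.
Proof.
  unfold trapezoid. apply Rabs_le. unfold Rmax, Rmin;
  repeat case_le; lra.
Qed.

Lemma trapezoid_one : const_near 1 0 (1 / 4) trapezoid.
Proof.
  intros y Hy. rewrite Rminus_0_r in Hy. unfold trapezoid, Rmax, Rmin;
  repeat case_le; lra.
Qed.

Lemma trapezoid_zero x : 1 < Rabs x -> const_near 0 x (1 / 4) trapezoid.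
Proof.
  intros Hx y Hy. pose proof (Rabs_triang_inv x y) as H.
  rewrite Rabs_minus_sym in H. unfold trapezoid, Rmax, Rmin;
  repeat case_le; lra.
Qed.

(** Nonquasianalyticity enters here: windows proportional to the reciprocals of
    the quotients are summable, and the product of the inverses of the first [p]
    of them is [N_p] up to a geometric factor. *)
Lemma flat_bump N : LC N -> nonquasianalytic N ->
  exists F, class_chain N F /\ (forall x, 1 < Rabs x -> F 0%nat x = 0) /\
    F 0%nat 0 = 1 /\ forall p, F (S p) 0 = 0.
Proof.
  intros H Hq. pose proof (proj1 H) as Hp. unfold nonquasianalytic in Hq.
  set (b := fun p => / quot N (S p)) in *.
  assert (Hb : forall k, 0 < b k) by (intros k; apply Rinv_0_lt_compat, quot_pos, Hp).
  assert (HS : 0 <= Series b).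
  { apply (tail_nonneg b 0 Hq). intros k; apply Rlt_le, Hb. }
  (* The windows must sum to at most [1/4], the radius on which the trapezoid is
     constant about [0] and about each point outside [[-1,1]]. *)
  set (s := / (4 * (Series b + 1))).
  assert (Hs : 0 < s) by (apply Rinv_0_lt_compat; lra).
  assert (Hs1 : s <= 1).
  { unfold s. rewrite <- Rinv_1. apply Rinv_le_contravar; lra. }
  set (a := fun k => s * b k).
  assert (Ha : forall k, 0 < a k) by (intros k; now apply Rmult_lt_0_compat).
  assert (Hsum : ex_series a) by (apply (ex_series_scal (V := R_NormedModule) s b), Hq).
  assert (HSa : Series a <= 1 / 4).
  { unfold a. rewrite Series_scal_l.
    apply Rmult_le_reg_l with (4 * (Series b + 1)); [lra|].
    unfold s. rewrite <- Rmult_assoc, Rinv_r; lra. }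
  assert (Hprod : forall p, invprod a p = 1 * ((/ s) ^ p * N p)).
  { induction p as [|p IH]; simpl invprod.
    - rewrite (proj1 (proj1 (proj2 H))). simpl. ring.
    - rewrite IH, (quot_step N p Hp). unfold a, b. simpl pow.
      field. split; apply Rgt_not_eq; first [exact Hs|apply quot_pos, Hp]. }
  exists (bump a trapezoid). split; [split|split; [|split]].
  - apply (bump_chain a trapezoid 2 Ha Hsum trapezoid_lip).
  - exists (/ s), 1. repeat split; [|lra|].
    + rewrite <- Rinv_1. apply Rinv_le_contravar; lra.
    + intros p x. rewrite <- Hprod.
      apply (bump_bound a trapezoid 2 Ha Hsum trapezoid_lip trapezoid_bound).
  - intros x Hx. now rewrite (bump_const a trapezoid 2 Ha Hsum trapezoid_lip 0 x _
      (trapezoid_zero x Hx) HSa).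
  - now rewrite (bump_const a trapezoid 2 Ha Hsum trapezoid_lip 1 0 _
      trapezoid_one HSa).
  - intros p. now rewrite (bump_const a trapezoid 2 Ha Hsum trapezoid_lip 1 0 _
      trapezoid_one HSa).
Qed.

(** * Products *)

(** The [p]-th derivative of a product, with the binomial sum left unexpanded:
    the recursion is the product rule itself, so that neither the derivative nor
    the estimates need binomial coefficients. *)
Fixpoint leibniz (p : nat) (U V : nat -> R -> R) (x : R) : R :=
  match p with
  | O => U 0%nat x * V 0%nat x
  | S q => leibniz q (fun k => U (S k)) V x + leibniz q U (fun k => V (S k)) x
  end.

Lemma leibniz_chain U V : chain U -> chain V -> chain (fun p => leibniz p U V).
Proof.
  intros HU HV p. revert U V HU HV.
  induction p as [|p IH]; intros U V HU HV x.
  - simpl. rewrite Rplus_comm.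
    evar_last.
    + apply (is_derive_mult (U 0%nat) (V 0%nat)); [apply HU|apply HV|].
      intros; apply Rmult_comm.
    + unfold plus, mult; simpl. ring.
  - apply (is_derive_plus (leibniz p (fun k => U (S k)) V)
      (leibniz p U (fun k => V (S k)))).
    + apply (IH (fun k => U (S k)) V); [apply (chain_shift U 1 HU)|exact HV].
    + apply (IH U (fun k => V (S k))); [exact HU|apply (chain_shift V 1 HV)].
Qed.

(** The shifts [i] and [j] make the induction go through, since the recursion
    replaces a factor by its derivative. Log-convexity is used as
    [N_i N_j <= N_(i+j)]. *)
Lemma leibniz_bound N : LC N -> forall h A B x p i j U V, 
  1 <= h -> 0 <= A -> 0 <= B ->
  (forall k, Rabs (U k x) <= A * (h ^ (i + k) * N (i + k)%nat)) ->
  (forall k, Rabs (V k x) <= B * (h ^ (j + k) * N (j + k)%nat)) ->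
  Rabs (leibniz p U V x)
    <= 2 ^ p * (A * B * (h ^ (i + j + p) * N (i + j + p)%nat)).
Proof.
  intros H h A B x p. induction p as [|p IH]; intros i j U V Hh HA HB HU HV.
  - simpl. rewrite Rabs_mult, Rmult_1_l.
    specialize (HU 0%nat). specialize (HV 0%nat).
    rewrite Nat.add_0_r in HU, HV. rewrite Nat.add_0_r.
    apply Rle_trans with ((A * (h ^ i * N i)) * (B * (h ^ j * N j))).
    + apply Rmult_le_compat; auto using Rabs_pos.
    + rewrite pow_add.
      replace (A * (h ^ i * N i) * (B * (h ^ j * N j)))
        with (A * B * (h ^ i * h ^ j) * (N i * N j)) by ring.
      rewrite <- (Rmult_assoc (A * B) (h ^ i * h ^ j)).
      apply Rmult_le_compat_l; [|apply weight_supermult, H].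
      apply Rmult_le_pos; apply Rmult_le_pos; try assumption; apply pow_le; lra.
  - simpl leibniz. apply Rle_trans with (1 := Rabs_triang _ _).
    assert (HU' : forall k, Rabs (U (S k) x)
        <= A * (h ^ (S i + k) * N (S i + k)%nat))
      by (intros k; rewrite Nat.add_succ_comm; apply HU).
    assert (HV' : forall k, Rabs (V (S k) x)
        <= B * (h ^ (S j + k) * N (S j + k)%nat))
      by (intros k; rewrite Nat.add_succ_comm; apply HV).
    pose proof (IH (S i) j (fun k => U (S k)) V Hh HA HB HU' HV) as E1.
    pose proof (IH i (S j) U (fun k => V (S k)) Hh HA HB HU HV') as E2.
    replace (i + S j + p)%nat with (i + j + S p)%nat in E2 by lia.
    replace (S i + j + p)%nat with (i + j + S p)%nat in E1 by lia.
    simpl pow in *. lra.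
Qed.

Lemma leibniz_zero_r x p U V : (forall k, V k x = 0) -> leibniz p U V x = 0.
Proof.
  revert U V. induction p as [|p IH]; intros U V HV; simpl.
  - rewrite HV. ring.
  - rewrite !IH; auto; ring.
Qed.

Lemma leibniz_one_r x p U V :
  V 0%nat x = 1 -> (forall k, V (S k) x = 0) -> leibniz p U V x = U p x.
Proof.
  intros H1 H0. revert U. induction p as [|p IH]; intros U; simpl.
  - rewrite H1. ring.
  - rewrite IH, leibniz_zero_r; auto. ring.
Qed.

Lemma class_chain_mul N U V : LC N -> class_chain N U -> class_chain N V ->
  class_chain N (fun p => leibniz p U V).
Proof.
  intros H [HU (h & A & Hh & HA & Hb)] [HV (h' & B & Hh' & HB & Hb')].
  split; [now apply leibniz_chain|].
  pose proof (proj1 H) as Hp.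
  set (m := Rmax h h').
  assert (Hm : 1 <= m) by (apply Rle_trans with (1 := Hh), Rmax_l).
  exists (2 * m), (A * B). repeat split; [lra|nra|].
  intros p x. rewrite Rpow_mult_distr.
  replace (A * B * (2 ^ p * m ^ p * N p)) with (2 ^ p * (A * B * (m ^ p * N p))) by ring.
  apply (leibniz_bound N H m A B x p 0 0); auto; intros k; simpl Nat.add.
  - apply Rle_trans with (1 := Hb k x). apply Rmult_le_compat_l; [exact HA|].
    apply Rmult_le_compat_r; [apply Rlt_le, Hp|].
    apply pow_incr. split; [lra|apply Rmax_l].
  - apply Rle_trans with (1 := Hb' k x). apply Rmult_le_compat_l; [exact HB|].
    apply Rmult_le_compat_r; [apply Rlt_le, Hp|].
    apply pow_incr. split; [lra|apply Rmax_r].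
Qed.

(** * A function with large derivatives at the origin *)

(** The phase [PI/4] keeps all derivatives of the sine away from zero at the
    origin, and makes their signs depend on [p] only. *)
Definition wave (p : nat) (y : R) : R := sin (y + PI / 4 + INR p * (PI / 2)).

Lemma wave_chain : chain wave.
Proof.
  intros p x. unfold wave. auto_derive; [exact I|].
  rewrite S_INR, Rmult_1_l, cos_sin. f_equal. ring.
Qed.

Lemma wave_bound p y : Rabs (wave p y) <= 1.
Proof. apply Rabs_le, SIN_bound. Qed.

Lemma wave_zero p : 1 / 2 <= Rabs (wave p 0).
Proof.
  assert (H : wave p 0 ^ 2 = 1 / 2).
  { assert (H0 : wave 0 0 ^ 2 = 1 / 2).
    { unfold wave. simpl INR. rewrite Rmult_0_l, Rplus_0_r, Rplus_0_l, sin_PI4.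
      unfold Rdiv. rewrite Rmult_1_l.
      pose proof (sqrt_sqrt 2 ltac:(lra)) as E. pose proof (sqrt_lt_R0 2 ltac:(lra)).
      simpl. field_simplify; [|lra]. rewrite <- Rsqr_pow2, Rsqr_sqrt; lra. }
    assert (H1 : forall p, wave (S p) 0 = cos (0 + PI / 4 + INR p * (PI / 2))).
    { intros q. unfold wave. rewrite S_INR, cos_sin. f_equal. ring. }
    induction p as [|p IH]; [exact H0|].
    rewrite H1. unfold wave in IH.
    pose proof (sin2_cos2 (0 + PI / 4 + INR p * (PI / 2))) as E.
    unfold Rsqr in E. simpl pow in *. lra. }
  apply Rsqr_incr_0_var; [|apply Rabs_pos].
  rewrite <- Rsqr_abs, (Rsqr_pow2 (wave p 0)), H. unfold Rsqr. lra.
Qed.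

(** The [p]-th derivative of [theta] superposes waves of frequency
    [2 * quot N j] with these weights. By [weight_tangent] the weights are at
    most [2^p N_p / 2^j], whereas the one of index [j = p] is [N_p]. *)
Definition theta_coeff (N : nat -> R) (p j : nat) : R :=
  N j / (2 * quot N j) ^ j * (2 * quot N j) ^ p.

Definition theta (N : nat -> R) (p : nat) (x : R) : R :=
  Series (fun j => theta_coeff N p j * wave p (2 * quot N j * x)).

Lemma theta_coeff_pos N p j : LC N -> 0 < theta_coeff N p j.
Proof.
  intros H. pose proof (proj1 H) as Hp. pose proof (quot_pos N j Hp).
  unfold theta_coeff. apply Rmult_lt_0_compat; [|apply pow_lt; lra].
  apply Rdiv_lt_0_compat; [apply Hp|apply pow_lt; lra].
Qed.

Lemma theta_coeff_le N p j : LC N ->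
  theta_coeff N p j <= 2 ^ p * N p * (1 / 2) ^ j.
Proof.
  intros H. pose proof (proj1 H) as Hp. pose proof (quot_pos N j Hp) as Hq.
  pose proof (pow_lt _ j Hq). pose proof (pow_lt 2 j ltac:(lra)).
  pose proof (pow_lt 2 p ltac:(lra)).
  unfold theta_coeff. rewrite !Rpow_mult_distr.
  replace ((1 / 2) ^ j) with (/ 2 ^ j)
    by (unfold Rdiv; rewrite Rmult_1_l; now rewrite pow_inv).
  apply Rmult_le_reg_r with (2 ^ j * quot N j ^ j); [nra|].
  replace (N j / (2 ^ j * quot N j ^ j) * (2 ^ p * quot N j ^ p) * (2 ^ j * quot N j ^ j))
    with (2 ^ p * (N j * quot N j ^ p)) by (field; lra).
  replace (2 ^ p * N p * / 2 ^ j * (2 ^ j * quot N j ^ j))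
    with (2 ^ p * (N p * quot N j ^ j)) by (field; lra).
  apply Rmult_le_compat_l; [lra|]. now apply weight_tangent.
Qed.

Lemma theta_coeff_summable N p : LC N -> ex_series (theta_coeff N p).
Proof.
  intros H.
  apply (ex_series_le (V := R_CompleteNormedModule) _
    (fun j => 2 ^ p * N p * (1 / 2) ^ j)).
  - intros j. change (norm (theta_coeff N p j)) with (Rabs (theta_coeff N p j)).
    rewrite Rabs_right by (apply Rle_ge, Rlt_le, theta_coeff_pos, H).
    now apply theta_coeff_le.
  - apply (ex_series_scal (V := R_NormedModule)), ex_series_geom.
    rewrite Rabs_right; lra.
Qed.

Lemma theta_coeff_sum N p : LC N -> Series (theta_coeff N p) <= 2 * (2 ^ p * N p).
Proof.
  intros H.
  apply Rle_trans with (Series (fun j => 2 ^ p * N p * (1 / 2) ^ j)).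
  - apply Series_le.
    + intros j; split; [apply Rlt_le, theta_coeff_pos, H|now apply theta_coeff_le].
    + apply (ex_series_scal (V := R_NormedModule)), ex_series_geom.
      rewrite Rabs_right; lra.
  - rewrite Series_scal_l, Series_geom by (rewrite Rabs_right; lra).
    apply Req_le. field.
Qed.

Lemma theta_term_le N p j x : LC N ->
  Rabs (theta_coeff N p j * wave p (2 * quot N j * x)) <= theta_coeff N p j.
Proof.
  intros H. pose proof (theta_coeff_pos N p j H) as Hc.
  rewrite Rabs_mult, Rabs_right by lra.
  pose proof (wave_bound p (2 * quot N j * x)). nra.
Qed.

Lemma theta_abs_summable N p x : LC N ->
  ex_series (fun j => Rabs (theta_coeff N p j * wave p (2 * quot N j * x))).
Proof.
  intros H.
  apply (ex_series_le (V := R_CompleteNormedModule) _ (theta_coeff N p));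
    [|now apply theta_coeff_summable].
  intros j. unfold norm; simpl; unfold abs; simpl. rewrite Rabs_Rabsolu. now apply theta_term_le.
Qed.

Lemma theta_chain N : LC N -> chain (theta N).
Proof.
  intros H p.
  set (term := fun p j x => theta_coeff N p j * wave p (2 * quot N j * x)).
  assert (Ht : forall j, chain (fun p => term p j)).
  { intros j q x. unfold term, theta_coeff.
    set (l := 2 * quot N j). cbv beta.
    apply is_derive_ext with (fun x => N j / l ^ j * (l ^ q * wave q (l * x)));
      [intros t; symmetry; apply Rmult_assoc|].
    replace (N j / l ^ j * l ^ S q * wave (S q) (l * x))
      with (N j / l ^ j * (l ^ S q * wave (S q) (l * x))) by ring.
    apply (is_derive_scal (fun x => l ^ q * wave q (l * x))).
    apply (chain_comp_scal wave l wave_chain q x). }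
  apply (is_derive_uniform_limit
    (fun n x => sum_n (fun j => term p j x) n)
    (fun n x => sum_n (fun j => term (S p) j x) n) _ _
    (fun n => tail (theta_coeff N (S p)) (S n))).
  - intros n x. apply (is_derive_sum_n (fun j => term p j)). intros j _. apply Ht.
  - intros n x. apply continuity_pt_filterlim.
    apply (ex_derive_continuous (fun x => sum_n (fun j => term (S p) j x) n) x).
    eexists. apply (is_derive_sum_n (fun j => term (S p) j)). intros j _. apply Ht.
  - intros x. apply (Series_correct (fun j => term p j x)).
    apply ex_series_Rabs, theta_abs_summable, H.
  - intros n x. apply series_remainder.
    + intros j. now apply theta_term_le.
    + now apply theta_coeff_summable.
  - apply (is_lim_seq_incr_1 (tail (theta_coeff N (S p)))), tail_lim.
    now apply theta_coeff_summable.
Qed.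

Lemma theta_class N : LC N -> class_chain N (theta N).
Proof.
  intros H. split; [now apply theta_chain|].
  exists 2, 2. repeat split; [lra|lra|]. intros p x.
  apply Rle_trans with (2 := theta_coeff_sum N p H).
  unfold theta. apply Rle_trans with (1 := Series_Rabs _ (theta_abs_summable N p x H)).
  apply Series_le; [|now apply theta_coeff_summable].
  intros j; split; [apply Rabs_pos|now apply theta_term_le].
Qed.

(** At the origin all summands have the sign of [wave p 0], so there is no
    cancellation and the summand [j = p] bounds the sum from below. *)
Lemma theta_large N p : LC N -> N p / 2 <= Rabs (theta N p 0).
Proof.
  intros H. pose proof (proj1 H) as Hp.
  unfold theta.
  rewrite (Series_ext _ (fun j => wave p 0 * theta_coeff N p j))
    by (intros j; rewrite Rmult_0_r; ring).
  rewrite Series_scal_l, Rabs_mult.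
  pose proof (wave_zero p) as Hw.
  assert (E : N p <= Series (theta_coeff N p)).
  { replace (N p) with (theta_coeff N p p).
    - apply term_le_series; [now apply theta_coeff_summable|].
      intros k; apply Rlt_le, theta_coeff_pos, H.
    - unfold theta_coeff. field. apply pow_nonzero.
      pose proof (quot_pos N p Hp). lra. }
  pose proof (Hp p). rewrite (Rabs_right (Series _)) by lra. nra.
Qed.

Lemma large_compact N : LC N -> nonquasianalytic N ->
  exists F, class_chain N F /\ (forall x, 1 < Rabs x -> F 0%nat x = 0) /\
    forall p, N p / 2 <= Rabs (F p 0).
Proof.
  intros H Hq. destruct (flat_bump N H Hq) as (B & HB & Hs & H1 & H0).
  exists (fun p => leibniz p (theta N) B). split; [|split].
  - apply class_chain_mul; [exact H|now apply theta_class|exact HB].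
  - intros x Hx. simpl. rewrite Hs by exact Hx. ring.
  - intros p. rewrite leibniz_one_r by assumption. now apply theta_large.
Qed.

(** * The Borel image *)

Definition compact_chain (N : nat -> R) (F : nat -> R -> R) : Prop :=
  class_chain N F /\ forall x, 1 < Rabs x -> F 0%nat x = 0.

Lemma geometric_weight_le N h m K K' p : pos_seq N ->
  0 <= h <= m -> 0 <= K <= K' -> K * (h ^ p * N p) <= K' * (m ^ p * N p).
Proof.
  intros Hp Hh HK. pose proof (Hp p). pose proof (pow_le h p (proj1 Hh)).
  apply Rmult_le_compat; [lra|nra|lra|].
  apply Rmult_le_compat_r; [lra|]. now apply pow_incr.
Qed.

Lemma compact_chain_lin N F G a b : pos_seq N ->
  compact_chain N F -> compact_chain N G ->
  compact_chain N (fun p x => a * F p x + b * G p x).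
Proof.
  intros Hp [[HF (h & K & Hh & HK & Hb)] HF0] [[HG (h' & K' & Hh' & HK' & Hb')] HG0].
  split; [split; [now apply chain_lin|]|].
  - exists (Rmax h h'), (Rabs a * K + Rabs b * K').
    pose proof (Rmax_l h h'). pose proof (Rmax_r h h').
    pose proof (Rabs_pos a). pose proof (Rabs_pos b).
    split; [lra|split; [nra|]]. intros p x.
    apply Rle_trans with (1 := Rabs_triang _ _). rewrite !Rabs_mult.
    pose proof (geometric_weight_le N h (Rmax h h') K K p Hp ltac:(lra) ltac:(lra)).
    pose proof (geometric_weight_le N h' (Rmax h h') K' K' p Hp ltac:(lra) ltac:(lra)).
    specialize (Hb p x). specialize (Hb' p x).
    rewrite Rmult_plus_distr_r, !Rmult_assoc.
    apply Rplus_le_compat; apply Rmult_le_compat_l; lra.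
  - intros x Hx. rewrite HF0, HG0 by exact Hx. ring.
Qed.

Lemma compact_chain_dilate N F l : pos_seq N -> 1 <= l -> compact_chain N F ->
  compact_chain N (fun p x => l ^ p * F p (l * x)).
Proof.
  intros Hp Hl [[HF (h & K & Hh & HK & Hb)] HF0].
  split; [split; [now apply chain_comp_scal|]|].
  - exists (l * h), K. split; [nra|split; [exact HK|]].
    intros p x. rewrite Rabs_mult, Rpow_mult_distr.
    rewrite (Rabs_right (l ^ p)) by (apply Rle_ge, pow_le; lra).
    replace (K * (l ^ p * h ^ p * N p)) with (l ^ p * (K * (h ^ p * N p))) by ring.
    apply Rmult_le_compat_l; [apply pow_le; lra|apply Hb].
  - intros x Hx. rewrite HF0; [ring|].
    rewrite Rabs_mult, (Rabs_right l) by lra. nra.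
Qed.

Lemma compact_chain_zero N : pos_seq N -> compact_chain N (fun _ _ => 0).
Proof.
  intros Hp. split; [split|].
  - intros p x. auto_derive; trivial.
  - exists 1, 0. split; [lra|split; [lra|]]. intros p x. rewrite Rabs_R0. lra.
  - reflexivity.
Qed.

Lemma im_le_Cmod (c : C) : Rabs (Im c) <= Cmod c.
Proof. apply Rle_trans with (2 := Rmax_Cmod c), Rmax_r. Qed.

(** Real and imaginary parts decouple, which reduces the analysis to real
    chains. *)
Lemma Borel_image_chains N a : pos_seq N ->
  Borel_image (Dspace N) a <->
  exists F G, compact_chain N F /\ compact_chain N G /\
    forall p, a p = (F p 0, G p 0).
Proof.
  intros Hp. split.
  - intros (f & (Hs & Hsupp & h & Hh & K & HK) & Ha).
    assert (H0 : forall x, 1 < Rabs x -> f x = RtoC 0).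
    { intros x Hx. destruct (Ceq_dec (f x) (RtoC 0)) as [E|E]; [exact E|exfalso].
      assert (Hx' : -1 <= x <= 1).
      { apply Hsupp. now apply adherence_P1. }
      apply Rabs_le_between in Hx'. lra. }
    assert (Hb : forall p x, Cmod (CDerive_n f p x)
              <= Rmax K 0 * (Rmax h 1 ^ p * N p)).
    { intros p x. specialize (HK p x).
      pose proof (Hp p). pose proof (pow_lt h p Hh).
      apply Rle_trans with (Rmax K 0 * (h ^ p * N p)).
      - apply Rmult_le_reg_r with (/ (h ^ p * N p)); [apply Rinv_0_lt_compat; nra|].
        rewrite Rmult_assoc, Rinv_r, Rmult_1_r by (apply Rgt_not_eq; nra).
        apply Rle_trans with (1 := HK), Rmax_l.
      - apply geometric_weight_le; [exact Hp| |].
        + split; [lra|apply Rmax_l].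
        + split; [apply Rmax_r|lra]. }
    assert (Hc : forall part : C -> R, (forall c, Rabs (part c) <= Cmod c) ->
      part (RtoC 0) = 0 ->
      (forall p x, part (CDerive_n f p x) = Derive_n (fun t => part (f t)) p x) ->
      (forall p x, ex_derive_n (fun t => part (f t)) p x) ->
      compact_chain N (Derive_n (fun t => part (f t)))).
    { intros part Hle Hz Hd Hex. split; [split|].
      - now apply chain_of_smooth.
      - exists (Rmax h 1), (Rmax K 0).
        split; [apply Rmax_r|split; [apply Rmax_r|]].
        intros p x. rewrite <- Hd. apply Rle_trans with (1 := Hle _), Hb.
      - intros x Hx. simpl. now rewrite H0. }
    exists (Derive_n (fun t => Re (f t))), (Derive_n (fun t => Im (f t))).
    split; [|split].
    + apply (Hc Re); [apply re_le_Cmod|reflexivity|reflexivity|apply Hs].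
    + apply (Hc Im); [apply im_le_Cmod|reflexivity|reflexivity|apply Hs].
    + intros p. now rewrite <- Ha.
  - intros (F & G & [[HF (h & K & Hh & HK & Hb)] HF0]
      & [[HG (h' & K' & Hh' & HK' & Hb')] HG0] & Ha).
    exists (fun x => (F 0%nat x, G 0%nat x)).
    assert (HD : forall p x, CDerive_n (fun x => (F 0%nat x, G 0%nat x)) p x
                   = (F p x, G p x)).
    { intros p x. unfold CDerive_n. simpl. f_equal; now apply chain_Derive_n. }
    split; [split; [|split]|].
    + intros n x. split; now apply chain_ex_derive_n.
    + intros x Hx. apply Rabs_le_between.
      destruct (Rle_or_lt (Rabs x) 1) as [H|H]; [exact H|exfalso].
      assert (Hd : 0 < Rabs x - 1) by lra.
      destruct (Hx (disc x (mkposreal _ Hd))) as [y [Hy Hy']].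
      { exists (mkposreal _ Hd). intros z Hz; exact Hz. }
      apply Hy'. unfold disc in Hy; simpl in Hy.
      pose proof (Rabs_triang_inv x y) as T. rewrite Rabs_minus_sym in T.
      now rewrite HF0, HG0 by lra.
    + exists (Rmax h h'). pose proof (Rmax_l h h') as H1. pose proof (Rmax_r h h') as H2.
      split; [lra|]. exists (2 * (K + K')).
      intros p x. rewrite HD. pose proof (Hp p).
      assert (0 < Rmax h h' ^ p) by (apply pow_lt; lra).
      apply Rmult_le_reg_r with (Rmax h h' ^ p * N p); [nra|].
      unfold Rdiv. rewrite Rmult_assoc, Rinv_l, Rmult_1_r by (apply Rgt_not_eq; nra).
      apply Rle_trans with (1 := Cmod_2Rmax _). simpl fst. simpl snd.
      pose proof (geometric_weight_le N h (Rmax h h') K (K + K') p Hp ltac:(lra) ltac:(lra)).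
      pose proof (geometric_weight_le N h' (Rmax h h') K' (K + K') p Hp ltac:(lra) ltac:(lra)).
      specialize (Hb p x). specialize (Hb' p x).
      rewrite Rmult_assoc. apply Rmult_le_compat; [apply sqrt_pos| | |].
      * apply Rle_trans with (2 := Rmax_l _ _), Rabs_pos.
      * apply Rle_trans with (sqrt (2 * 2)); [apply sqrt_le_1_alt; lra|].
        rewrite sqrt_square; lra.
      * apply Rmax_lub; lra.
    + apply functional_extensionality. intros p. unfold Borel. rewrite HD. now rewrite Ha.
Qed.

Lemma Borel_image_subspace N : pos_seq N -> subspace (Borel_image (Dspace N)).
Proof.
  intros Hp. split; [|split].
  - apply Borel_image_chains; [exact Hp|].
    exists (fun _ _ => 0), (fun _ _ => 0).
    split; [|split]; [now apply compact_chain_zero..|reflexivity].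
  - intros a b Ha Hb.
    apply (Borel_image_chains N a Hp) in Ha. apply (Borel_image_chains N b Hp) in Hb.
    destruct Ha as (F & G & HF & HG & Ha). destruct Hb as (F' & G' & HF' & HG' & Hb).
    apply Borel_image_chains; [exact Hp|].
    exists (fun p x => 1 * F p x + 1 * F' p x), (fun p x => 1 * G p x + 1 * G' p x).
    split; [|split]; [now apply compact_chain_lin..|].
    intros p. rewrite Ha, Hb. unfold Cplus; simpl. f_equal; ring.
  - intros c a Ha. apply (Borel_image_chains N a Hp) in Ha.
    destruct Ha as (F & G & HF & HG & Ha).
    apply Borel_image_chains; [exact Hp|].
    exists (fun p x => fst c * F p x + (- snd c) * G p x),
      (fun p x => fst c * G p x + snd c * F p x).
    split; [|split]; [now apply compact_chain_lin..|].
    intros p. rewrite Ha. unfold Cmult; simpl. f_equal; ring.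
Qed.

(** * Quantitative quasianalyticity *)

Lemma le_of_derive_le u u' v v' a b : a <= b ->
  (forall x, is_derive u x (u' x)) -> (forall x, is_derive v x (v' x)) ->
  (forall x, a <= x <= b -> u' x <= v' x) -> u a <= v a -> u b <= v b.
Proof.
  intros Hab Hu Hv Hle H0.
  assert (Hd : forall x, is_derive (fun x => v x - u x) x (v' x - u' x)).
  { intros x. apply (is_derive_minus v u); [apply Hv|apply Hu]. }
  destruct (MVT_gen (fun x => v x - u x) a b (fun x => v' x - u' x)) as [c [Hc E]].
  - intros; apply Hd.
  - intros x _. apply continuity_pt_filterlim.
    apply (ex_derive_continuous (fun x => v x - u x) x). eexists; apply Hd.
  - rewrite Rmin_left, Rmax_right in Hc by exact Hab.
    specialize (Hle c Hc). nra.
Qed.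

(** Bang's method. In this section [hconv] says that the ratios
    [M (S j) / M j] increase. *)

Section Bang.

Variables (G : nat -> R -> R) (M : nat -> R).
Hypotheses (hG : chain G) (hM : forall j, 0 < M j)
  (hconv : forall j m, (j <= m)%nat -> M (S j) * M m <= M j * M (S m))
  (hb : forall j x, Rabs (G j x) <= M j).

(** Flatness of order [m] at [x], weighted so that the derivatives of order at
    least [m] satisfy it automatically by the global bound [hb]. *)
Definition bang_flat (m : nat) (x : R) : Prop :=
  forall j, Rabs (G j x) <= exp (INR j - INR m) * M j.

(** The distance over which one order of flatness is lost. *)
Definition bang_width (m : nat) : R := M m / (exp 1 * M (S m)).

Fixpoint bang_dist (m l : nat) : R :=
  match l with O => 0 | S k => bang_dist m k + bang_width (m + k) end.

Lemma bang_flat_trivial m x j : (m <= j)%nat ->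
  Rabs (G j x) <= exp (INR j - INR m) * M j.
Proof.
  intros Hj. apply Rle_trans with (1 := hb j x).
  apply le_INR in Hj. pose proof (exp_ineq1_le (INR j - INR m)). specialize (hM j). nra.
Qed.

Lemma bang_width_pos m : 0 < bang_width m.
Proof.
  apply Rdiv_lt_0_compat; [apply hM|].
  apply Rmult_lt_0_compat; [apply exp_pos|apply hM].
Qed.

(** Going down from order [S m], each derivative is integrated from the bound on
    the next one; the exponential with rate [1 / bang_width m] reproduces itself
    under this because the ratios of [M] increase. Over one width it grows by the
    factor [exp 1], which is one order of flatness. *)
Lemma bang_step m x h : bang_flat (S m) x -> 0 <= h <= bang_width m ->
  bang_flat m (x + h).
Proof.
  intros HQ Hh.
  set (rho := / bang_width m).
  pose proof (bang_width_pos m) as Hw.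
  assert (Hrho : 0 < rho) by (now apply Rinv_0_lt_compat).
  assert (Hclaim : forall i, (i <= S m)%nat -> forall s, 0 <= s <= h ->
    Rabs (G (S m - i) (x + s))
      <= exp (INR (S m - i) - INR (S m)) * M (S m - i)%nat * exp (rho * s)).
  { induction i as [|i IH]; intros Hi s Hs.
    - rewrite Nat.sub_0_r.
      apply Rle_trans with (1 := bang_flat_trivial (S m) (x + s) (S m) (le_n _)).
      pose proof (exp_ineq1_le (rho * s)).
      assert (0 <= rho * s) by (apply Rmult_le_pos; lra).
      assert (0 < exp (INR (S m) - INR (S m)) * M (S m))
        by (apply Rmult_lt_0_compat; [apply exp_pos|apply hM]).
      nra.
    - set (j := (S m - S i)%nat).
      assert (Hj : (S m - i)%nat = S j) by (unfold j; lia).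
      rewrite Hj in IH. specialize (IH ltac:(lia)).
      set (A := exp (INR j - INR (S m)) * M j).
      assert (HA : 0 < A) by (apply Rmult_lt_0_compat; [apply exp_pos|apply hM]).
      assert (Hslope : exp (INR (S j) - INR (S m)) * M (S j) <= A * rho).
      { unfold A, rho, bang_width. rewrite S_INR.
        replace (INR j + 1 - INR (S m)) with ((INR j - INR (S m)) + 1) by ring.
        rewrite exp_plus.
        pose proof (hconv j m ltac:(unfold j; lia)) as E.
        pose proof (hM m). pose proof (hM (S m)). pose proof (exp_pos 1).
        pose proof (exp_pos (INR j - INR (S m))).
        replace (exp (INR j - INR (S m)) * M j * / (M m / (exp 1 * M (S m))))
          with (exp (INR j - INR (S m)) * exp 1 * (M j * M (S m) / M m))
          by (field; lra).
        apply Rmult_le_compat_l; [nra|].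
        apply Rmult_le_reg_r with (M m); [assumption|].
        unfold Rdiv. rewrite (Rmult_assoc _ (/ M m)), Rinv_l, Rmult_1_r; lra. }
      set (v := fun t => A * exp (rho * (t - x))).
      set (v' := fun t => A * (rho * exp (rho * (t - x)))).
      assert (Hv : forall t, is_derive v t (v' t)).
      { intros t. unfold v, v'. auto_derive; [exact I|]. unfold Rminus. ring. }
      assert (HG' : forall t, x <= t <= x + s -> Rabs (G (S j) t) <= v' t).
      { intros t Ht. specialize (IH (t - x) ltac:(lra)).
        replace (x + (t - x)) with t in IH by ring.
        apply Rle_trans with (1 := IH). unfold v'.
        rewrite <- Rmult_assoc. apply Rmult_le_compat_r; [apply Rlt_le, exp_pos|exact Hslope]. }
      assert (H0 : Rabs (G j x) <= v x).
      { unfold v. rewrite Rminus_diag, Rmult_0_r, exp_0, Rmult_1_r. apply HQ. }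
      assert (Hend : v (x + s) = A * exp (rho * s)).
      { unfold v. replace (x + s - x) with s by ring. reflexivity. }
      rewrite <- Hend. apply Rabs_le_between in H0. apply Rabs_le. split.
      + apply Ropp_le_cancel. rewrite Ropp_involutive.
        apply (le_of_derive_le (fun t => - G j t) (fun t => - G (S j) t) v v' x (x + s));
          [lra| |exact Hv| |lra].
        * intros t. apply (is_derive_opp (G j)), hG.
        * intros t Ht. specialize (HG' t Ht). apply Rabs_le_between in HG'. lra.
      + apply (le_of_derive_le (G j) (G (S j)) v v' x (x + s));
          [lra|apply hG|exact Hv| |lra].
        intros t Ht. specialize (HG' t Ht). apply Rabs_le_between in HG'. lra. }
  intros j. destruct (Nat.le_gt_cases j m) as [Hjm|Hjm];
    [|apply bang_flat_trivial; lia].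
  specialize (Hclaim (S m - j)%nat ltac:(lia) h ltac:(lra)).
  replace (S m - (S m - j))%nat with j in Hclaim by lia.
  apply Rle_trans with (1 := Hclaim).
  replace (INR j - INR m) with ((INR j - INR (S m)) + 1) by (rewrite S_INR; ring).
  rewrite exp_plus.
  assert (rho * h <= 1).
  { apply Rmult_le_reg_l with (bang_width m); [exact Hw|].
    unfold rho. rewrite <- Rmult_assoc, Rinv_r; lra. }
  assert (exp (rho * h) <= exp 1)
    by (destruct (Rle_lt_or_eq_dec _ _ H) as [Hlt| ->]; [apply Rlt_le, exp_increasing, Hlt|lra]).
  rewrite Rmult_assoc, Rmult_assoc.
  apply Rmult_le_compat_l; [apply Rlt_le, exp_pos|].
  rewrite Rmult_comm. apply Rmult_le_compat_r; [apply Rlt_le, hM|assumption].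
Qed.

Lemma bang_dist_nonneg m l : 0 <= bang_dist m l.
Proof.
  induction l as [|l IH]; simpl; [lra|]. pose proof (bang_width_pos (m + l)). lra.
Qed.

Lemma bang_spread m l : forall x h, bang_flat (m + l) x ->
  0 <= h <= bang_dist m l -> bang_flat m (x + h).
Proof.
  induction l as [|l IH]; intros x h HQ Hh; simpl in Hh.
  - rewrite Nat.add_0_r in HQ. replace (x + h) with x by lra. exact HQ.
  - rewrite <- plus_n_Sm in HQ.
    pose proof (bang_width_pos (m + l)) as Hw.
    destruct (Rle_or_lt h (bang_width (m + l))) as [Hs|Hs].
    + replace (x + h) with ((x + h) + 0) by ring.
      apply IH; [|pose proof (bang_dist_nonneg m l); lra].
      apply bang_step; [exact HQ|lra].
    + replace (x + h) with ((x + bang_width (m + l)) + (h - bang_width (m + l))) by ring.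
      apply IH; [|lra]. apply bang_step; [exact HQ|lra].
Qed.

(** A function flat to order [m + l] at the origin stays of size [exp (-m)]
    over a distance that is a partial sum of the reciprocals of the ratios of
    [M]. *)
Lemma bang_estimate m l : (forall j, (j < m + l)%nat -> G j 0 = 0) ->
  forall x, 0 <= x <= bang_dist m l -> Rabs (G 0%nat x) <= exp (- INR m) * M 0%nat.
Proof.
  intros H0 x Hx.
  assert (HQ : bang_flat (m + l) 0).
  { intros j. destruct (Nat.lt_ge_cases j (m + l)) as [Hj|Hj].
    - rewrite H0, Rabs_R0 by exact Hj.
      apply Rmult_le_pos; apply Rlt_le; [apply exp_pos|apply hM].
    - now apply bang_flat_trivial. }
  pose proof (bang_spread m l 0 x HQ Hx 0%nat) as E.
  rewrite Rplus_0_l in E. simpl INR in E.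
  now replace (0 - INR m) with (- INR m) in E by ring.
Qed.

End Bang.

(** Integrating a lower bound [q] times would give [c x^q / q!]; the weaker
    [c (x/q)^q] reproduces itself without factorials. *)
Lemma taylor_lower F c q t : chain F -> 0 <= c -> (1 <= q)%nat ->
  (forall x, 0 <= x <= t -> c <= F q x) -> (forall j, (j < q)%nat -> F j 0 = 0) ->
  forall x, 0 <= x <= t -> c * (x / INR q) ^ q <= F 0%nat x.
Proof.
  intros HF Hc Hq Hlow H0.
  assert (Hq' : 0 < INR q) by (apply lt_0_INR; lia).
  assert (E : forall i, (i <= q)%nat -> forall x, 0 <= x <= t ->
    c * (x / INR q) ^ i <= F (q - i)%nat x).
  { induction i as [|i IH]; intros Hi x Hx.
    - rewrite Nat.sub_0_r. simpl. rewrite Rmult_1_r. now apply Hlow.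
    - assert (Hj : (q - i)%nat = S (q - S i)) by lia. rewrite Hj in IH.
      apply (le_of_derive_le (fun x => c * (x / INR q) ^ S i)
        (fun x => c * (INR (S i) / INR q * (x / INR q) ^ i))
        (F (q - S i)%nat) (F (S (q - S i))) 0 x); [lra| |apply HF| |].
      + intros y. auto_derive; [exact I|].
        change (match i with O => 1 | S _ => INR i + 1 end) with (INR (S i)).
        unfold Rdiv. simpl Nat.pred. ring.
      + intros y Hy. apply Rle_trans with (2 := IH ltac:(lia) y ltac:(lra)).
        apply Rmult_le_compat_l; [exact Hc|].
        rewrite <- (Rmult_1_l ((y / INR q) ^ i)) at 2.
        apply Rmult_le_compat_r.
        * apply pow_le, Rmult_le_pos; [lra|apply Rlt_le, Rinv_0_lt_compat, Hq'].
        * apply Rmult_le_reg_r with (INR q); [exact Hq'|].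
          unfold Rdiv. rewrite Rmult_assoc, Rinv_l, Rmult_1_l, Rmult_1_r by lra.
          now apply le_INR.
      + rewrite H0 by lia. unfold Rdiv. rewrite Rmult_0_l. simpl. lra. }
  intros x Hx. specialize (E q (le_n q) x Hx). now rewrite Nat.sub_diag in E.
Qed.

(** * What a lacunary Taylor expansion costs *)

(** Indexed from [0]: the tail of [recip N] from [p] sums [1 / quot N k] over
    [k > p]. *)
Definition recip (N : nat -> R) (k : nat) : R := / quot N (S k).

Lemma recip_pos N k : pos_seq N -> 0 < recip N k.
Proof. intros H. now apply Rinv_0_lt_compat, quot_pos. Qed.

Lemma class_ratio_monotone N n C s j m : LC N -> 0 < n -> 0 < C ->
  (j <= m)%nat ->
  let M := fun j => C * (n ^ (s + j) * N (s + j)%nat) in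
  M (S j) * M m <= M j * M (S m).
Proof.
  intros H Hn HC Hjm M. pose proof (proj1 H) as Hp. unfold M.
  rewrite <- !plus_n_Sm, !(quot_step N (s + _) Hp), <- !tech_pow_Rmult.
  set (P := C * (n ^ (s + j) * N (s + j)%nat)).
  set (Q := C * (n ^ (s + m) * N (s + m)%nat)).
  replace (C * (n * n ^ (s + j) * (quot N (S (s + j)) * N (s + j)%nat)) * Q)
    with (n * P * Q * quot N (S (s + j))) by (unfold P; ring).
  replace (P * (C * (n * n ^ (s + m) * (quot N (S (s + m)) * N (s + m)%nat))))
    with (n * P * Q * quot N (S (s + m))) by (unfold Q; ring).
  apply Rmult_le_compat_l; [|apply quot_incr; [exact H|lia]].
  assert (forall k, 0 < C * (n ^ k * N k)).
  { intros k. apply Rmult_lt_0_compat; [exact HC|].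
    apply Rmult_lt_0_compat; [now apply pow_lt|apply Hp]. }
  apply Rmult_le_pos; [apply Rmult_le_pos|]; apply Rlt_le; unfold P, Q; auto.
Qed.

(** Put [p = 2q]. The function [F p - N_p] is flat to order [K] at the origin, so by
    [bang_estimate] it stays below [N_p / 2] up to a distance [t] which is the
    difference of tails, up to constants. Hence [F p >= N_p / 2] on [[0,t]], and
    since the derivatives of order [q] to [p - 1] vanish at the origin,
    [F q t >= (N_p / 2) (t/q)^q]. With the class bound on [F q] and
    [N_p / N_q >= (quot N q)^q] this forces [t] to be at most a constant times
    [q / quot N q]. *)
Lemma gap_estimate N F n C A q K :
  LC N -> ex_series (recip N) -> chain F -> 1 <= n -> 0 <= C ->
  (forall p x, Rabs (F p x) <= C * (n ^ p * N p)) ->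
  2 * (C + 1) * n ^ 2 <= exp (INR A) -> (1 <= q)%nat ->
  F (2 * q)%nat 0 = N (2 * q)%nat ->
  (forall j, (q <= j < 2 * q)%nat -> F j 0 = 0) ->
  (forall j, (2 * q < j < 2 * q + K)%nat -> F j 0 = 0) ->
  tail (recip N) (2 * q + A * q) - tail (recip N) (2 * q + K)
    <= exp 1 * n ^ 2 * (1 + 2 * C) * (INR q / quot N q).
Proof.
  intros H Hs HF Hn HC Hb HA Hq Hval Hbelow Habove.
  pose proof (proj1 H) as Hp.
  pose proof (quot_pos N q Hp) as Hnu.
  assert (Hq' : 1 <= INR q) by (apply (le_INR 1); exact Hq).
  assert (Hpos : 0 <= INR q / quot N q).
  { apply Rmult_le_pos; [lra|now apply Rlt_le, Rinv_0_lt_compat]. }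
  pose proof (exp_pos 1) as He.
  assert (Hrhs : 0 <= exp 1 * n ^ 2 * (1 + 2 * C) * (INR q / quot N q)).
  { apply Rmult_le_pos; [|exact Hpos]. apply Rmult_le_pos; [|lra].
    apply Rmult_le_pos; [lra|apply pow_le; lra]. }
  (* [exp (-m)] beats the ratio between the bound on [G 0] and [N_(2q) / 2]. *)
  set (m := (A * q)%nat).
  destruct (Nat.le_gt_cases K m) as [HKm|HKm].
  { pose proof (tail_le (recip N) (2 * q + K) (2 * q + m) Hs
      (fun k => Rlt_le _ _ (recip_pos N k Hp)) ltac:(lia)). lra. }
  set (l := (K - m)%nat). assert (HK : K = (m + l)%nat) by (unfold l; lia).
  set (G := fun j x => match j with
                       | O => F (2 * q)%nat x - N (2 * q)%nat
                       | S _ => F (2 * q + j)%nat x end).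
  set (M := fun j => (C + 1) * (n ^ (2 * q + j) * N (2 * q + j)%nat)).
  assert (HMpos : forall j, 0 < M j).
  { intros j. apply Rmult_lt_0_compat; [lra|].
    apply Rmult_lt_0_compat; [apply pow_lt; lra|apply Hp]. }
  assert (HG : chain G).
  { intros [|j] x.
    - unfold G. rewrite Nat.add_1_r.
      evar_last; [apply (is_derive_minus (F (2 * q)%nat) (fun _ => N (2 * q)%nat));
        [apply HF|apply (is_derive_const (V := R_NormedModule))]|].
      exact (Rminus_0_r _).
    - exact (chain_shift F (2 * q) HF (S j) x). }
  assert (HGb : forall j x, Rabs (G j x) <= M j).
  { intros j x. pose proof (Hb (2 * q + j)%nat x) as E.
    pose proof (Hp (2 * q + j)%nat). pose proof (pow_R1_Rle n (2 * q + j) Hn).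
    unfold M. rewrite Rmult_plus_distr_r, Rmult_1_l.
    destruct j as [|j]; unfold G; cbv iota beta.
    - rewrite Nat.add_0_r in *. unfold Rminus.
      apply Rle_trans with (1 := Rabs_triang _ _).
      rewrite Rabs_Ropp, (Rabs_right (N _)) by lra.
      apply Rplus_le_compat; [exact E|]. nra.
    - pose proof (Rmult_lt_0_compat (n ^ (2 * q + S j)) (N (2 * q + S j)%nat)
        ltac:(lra) ltac:(lra)). lra. }
  set (t := bang_dist M m l).
  assert (Ht : t * (exp 1 * n)
    = tail (recip N) (2 * q + m) - tail (recip N) (2 * q + K)).
  { unfold t. rewrite HK. clear -Hp Hs Hn HMpos He HC. induction l as [|l IH]; simpl bang_dist.
    - rewrite Nat.add_0_r. ring.
    - rewrite Rmult_plus_distr_r, IH.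
      replace (2 * q + (m + S l))%nat with (S (2 * q + (m + l))) by lia.
      rewrite (tail_step (recip N) (2 * q + (m + l)) Hs).
      enough (bang_width M (m + l) * (exp 1 * n) = recip N (2 * q + (m + l))) by lra.
      unfold bang_width, recip, M.
      rewrite <- plus_n_Sm, (quot_step N _ Hp), <- tech_pow_Rmult.
      pose proof (quot_pos N (S (2 * q + (m + l))) Hp).
      pose proof (Hp (2 * q + (m + l))%nat).
      pose proof (pow_lt n (2 * q + (m + l)) ltac:(lra)).
      field. repeat split; apply Rgt_not_eq; lra. }
  assert (Ht0 : 0 <= t) by (apply bang_dist_nonneg, HMpos).
  assert (Hlow : forall x, 0 <= x <= t -> N (2 * q)%nat / 2 <= F (q + q)%nat x).
  { intros x Hx.
    pose proof (bang_estimate G M HG HMpos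
      (fun j k => class_ratio_monotone N n (C + 1) (2 * q) j k H ltac:(lra) ltac:(lra))
      HGb m l) as E.
    assert (E0 : forall j, (j < m + l)%nat -> G j 0 = 0).
    { intros [|j] Hj; unfold G; cbv iota beta.
      - rewrite Hval. ring.
      - apply Habove. lia. }
    specialize (E E0 x Hx). unfold M in E. unfold G in E; cbv iota beta in E. rewrite Nat.add_0_r in E.
    assert (Hexp : 2 * (C + 1) * n ^ (2 * q) <= exp (INR m)).
    { unfold m. rewrite mult_INR.
      replace (exp (INR A * INR q)) with (exp (INR A) ^ q)
        by (rewrite <- Rpower_pow by apply exp_pos; unfold Rpower; rewrite ln_exp;
            f_equal; ring).
      apply Rle_trans with ((2 * (C + 1) * n ^ 2) ^ q).
      - rewrite Rpow_mult_distr, <- pow_mult.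
        apply Rmult_le_compat_r; [apply pow_le; lra|].
        rewrite <- (pow_1 (2 * (C + 1))) at 1. apply Rle_pow; [lra|exact Hq].
      - apply pow_incr. split; [|exact HA].
        apply Rmult_le_pos; [lra|apply pow_le; lra]. }
    assert (Hsmall : exp (- INR m) * ((C + 1) * (n ^ (2 * q) * N (2 * q)%nat))
       <= N (2 * q)%nat / 2).
    { rewrite exp_Ropp.
      apply Rmult_le_reg_l with (exp (INR m)); [apply exp_pos|].
      rewrite <- Rmult_assoc, Rinv_r, Rmult_1_l by (apply Rgt_not_eq, exp_pos).
      pose proof (Hp (2 * q)%nat). nra. }
    pose proof (Rle_trans _ _ _ E Hsmall) as E1. apply Rabs_le_between in E1.
    replace (q + q)%nat with (2 * q)%nat by lia. lra. }
  assert (Htay := taylor_lower (fun j => F (q + j)%nat) (N (2 * q)%nat / 2) q t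
    (chain_shift F q HF) ltac:(pose proof (Hp (2 * q)%nat); lra) Hq Hlow
    ltac:(intros j Hj; apply Hbelow; lia) t ltac:(lra)).
  cbv beta in Htay. rewrite Nat.add_0_r in Htay.
  assert (Hup : F q t <= C * (n ^ q * N q)).
  { apply Rle_trans with (2 := Hb q t), Rle_abs. }
  assert (Hgrow : N q * quot N q ^ q <= N (2 * q)%nat).
  { replace (2 * q)%nat with (q + q)%nat by lia. now apply weight_growth. }
  set (y := t * quot N q / (n * INR q)).
  assert (Hypow : y ^ q <= 2 * C).
  { pose proof (Hp q) as HNq.
    pose proof (pow_lt n q ltac:(lra)) as Hnq.
    assert (0 <= (t / INR q) ^ q).
    { apply pow_le, Rmult_le_pos; [exact Ht0|apply Rlt_le, Rinv_0_lt_compat; lra]. }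
    apply Rmult_le_reg_r with (n ^ q * N q); [nra|].
    assert (Ey : y ^ q * (n ^ q * N q) = (t / INR q) ^ q * (N q * quot N q ^ q)).
    { replace ((t / INR q) ^ q * (N q * quot N q ^ q))
        with ((t / INR q * quot N q) ^ q * N q) by (rewrite Rpow_mult_distr; ring).
      replace (y ^ q * (n ^ q * N q)) with ((y * n) ^ q * N q)
        by (rewrite Rpow_mult_distr; ring).
      f_equal. f_equal. unfold y. field. lra. }
    rewrite Ey. nra. }
  assert (Hy : y <= 1 + 2 * C).
  { destruct (Rle_or_lt y (1 + 2 * C)) as [|Hlt]; [assumption|exfalso].
    assert (y ^ 1 <= y ^ q) by (apply Rle_pow; [lra|exact Hq]).
    rewrite pow_1 in *. lra. }
  rewrite <- Ht.
  replace (t * (exp 1 * n)) with (exp 1 * n ^ 2 * y * (INR q / quot N q))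
    by (unfold y; field; lra).
  apply Rmult_le_compat_r; [exact Hpos|].
  apply Rmult_le_compat_l; [|exact Hy].
  apply Rmult_le_pos; [lra|apply pow_le; lra].
Qed.

Lemma tail_recip_drop N p l : LC N -> ex_series (recip N) ->
  tail (recip N) p <= INR l * / quot N (S p) + tail (recip N) (p + l).
Proof.
  intros H Hs. induction l as [|l IH].
  - rewrite Nat.add_0_r. simpl. lra.
  - rewrite <- plus_n_Sm, S_INR. rewrite (tail_step _ (p + l) Hs) in IH.
    assert (recip N (p + l) <= / quot N (S p)).
    { apply Rinv_le_contravar; [apply quot_pos, H|apply quot_incr; [exact H|lia]]. }
    lra.
Qed.

(** The failure of [gamma1] compares tails of [recip N] with this quantity. *)
Definition ratio (N : nat -> R) (q : nat) : R := INR q / quot N q.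

Lemma ratio_pos N q : pos_seq N -> (1 <= q)%nat -> 0 < ratio N q.
Proof.
  intros Hp Hq. apply Rdiv_lt_0_compat; [apply lt_0_INR; lia|now apply quot_pos].
Qed.

(** The constant does not depend on [q]: the indices from [q] to [(2 + A) q],
    which [gap_estimate] does not see, contribute at most [(2 + A) q / quot N q]
    to the tail by monotonicity of the quotients. *)
Lemma gamma1_value_bound N F n C :
  LC N -> ex_series (recip N) -> chain F -> 1 <= n -> 0 <= C ->
  (forall p x, Rabs (F p x) <= C * (n ^ p * N p)) ->
  exists B, forall q q', (1 <= q)%nat -> (q < q')%nat ->
    F (2 * q)%nat 0 = N (2 * q)%nat ->
    (forall j, (q <= j < 2 * q)%nat -> F j 0 = 0) ->
    (forall j, (2 * q < j < 2 * q')%nat -> F j 0 = 0) ->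
    tail (recip N) (2 * q') <= ratio N q ->
    tail (recip N) (q - 1) <= B * ratio N q.
Proof.
  intros H Hs HF Hn HC Hb.
  (* [exp (A q)] is then at least twice the ratio [(C + 1) n^(2q)] between the
     class bound of order [2q] and [N_(2q)]. *)
  destruct (INR_unbounded (2 * (C + 1) * n ^ 2)) as [A HA].
  assert (HA' : 2 * (C + 1) * n ^ 2 <= exp (INR A)).
  { pose proof (exp_ineq1_le (INR A)). lra. }
  exists (INR (2 + A) + exp 1 * n ^ 2 * (1 + 2 * C) + 1).
  intros q q' Hq Hqq' Hval Hbelow Habove Htail.
  pose proof (gap_estimate N F n C A q (2 * q' - 2 * q) H Hs HF Hn HC Hb HA' Hq
    Hval Hbelow) as E.
  replace (2 * q + (2 * q' - 2 * q))%nat with (2 * q')%nat in E by lia.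
  specialize (E Habove).
  pose proof (tail_recip_drop N (q - 1) ((1 + A) * q + 1) H Hs) as D.
  replace (S (q - 1)) with q in D by lia.
  replace (q - 1 + ((1 + A) * q + 1))%nat with (2 * q + A * q)%nat in D by lia.
  assert (INR ((1 + A) * q + 1) * / quot N q <= INR (2 + A) * ratio N q).
  { unfold ratio, Rdiv. rewrite <- Rmult_assoc, <- mult_INR.
    apply Rmult_le_compat_r; [apply Rlt_le, Rinv_0_lt_compat, quot_pos, H|].
    apply le_INR. lia. }
  unfold ratio in *. lra.
Qed.

Lemma finite_bound (f : nat -> R) n : exists B, forall j, (j < n)%nat -> f j <= B.
Proof.
  induction n as [|n [B HB]]; [exists 0; intros; lia|].
  exists (Rmax B (f n)). intros j Hj.
  destruct (Nat.eq_dec j n) as [->|]; [apply Rmax_r|].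
  apply Rle_trans with (2 := Rmax_l _ _), HB. lia.
Qed.

Lemma not_gamma1_large N : pos_seq N -> ex_series (recip N) -> ~ gamma1 N ->
  forall B q0, exists q, (q0 <= q)%nat /\ (1 <= q)%nat /\
    B * ratio N q < tail (recip N) (q - 1).
Proof.
  intros Hp Hs Hg B q0. apply NNPP. intros Hno. apply Hg. split; [exact Hs|].
  set (f := fun j => quot N j / INR j * Series (fun k => / quot N (j + k))).
  destruct (finite_bound f q0) as [B' HB'].
  exists (Rmax B' B). intros j Hj. fold (f j).
  destruct (Nat.lt_ge_cases j q0) as [Hlt|Hge].
  - apply Rle_trans with (2 := Rmax_l _ _). now apply HB'.
  - apply Rle_trans with (2 := Rmax_r _ _).
    destruct (Rle_or_lt (f j) B) as [|Hlt]; [assumption|exfalso].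
    apply Hno. exists j. split; [exact Hge|split; [exact Hj|]].
    pose proof (ratio_pos N j Hp Hj) as Hr.
    assert (E : f j = / ratio N j * tail (recip N) (j - 1)).
    { unfold f, ratio, tail, recip. rewrite Rinv_div. f_equal.
      apply Series_ext. intros k. do 2 f_equal. lia. }
    rewrite E in Hlt. apply Rmult_lt_reg_l with (/ ratio N j);
      [now apply Rinv_0_lt_compat|].
    replace (/ ratio N j * (B * ratio N j)) with B by (field; lra). exact Hlt.
Qed.

(** Indices at which [gamma1] fails worse and worse, so sparse that the tail
    beyond the double of the next one is dominated by [ratio] at the current one. *)
Lemma lacunary_indices N q0 : pos_seq N -> ex_series (recip N) -> ~ gamma1 N ->
  exists s : nat -> nat, (q0 <= s 0%nat)%nat /\
    (forall i, (2 * s i < s (S i))%nat) /\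
    (forall i, INR i * ratio N (s (S i)) < tail (recip N) (s (S i) - 1)) /\
    (forall i, (1 <= s i)%nat -> tail (recip N) (2 * s (S i)) <= ratio N (s i)).
Proof.
  intros Hp Hs Hg.
  assert (Hnext : forall c : nat * nat, exists q', (2 * snd c < q')%nat /\
    INR (fst c) * ratio N q' < tail (recip N) (q' - 1) /\
    ((1 <= snd c)%nat -> tail (recip N) (2 * q') <= ratio N (snd c))).
  { intros [i q]; simpl fst; simpl snd.
    assert (HR : exists r, (1 <= q)%nat -> forall q', (r <= q')%nat ->
      tail (recip N) q' <= ratio N q).
    { destruct (Nat.lt_ge_cases q 1) as [Hq|Hq]; [exists 0%nat; lia|].
      pose proof (proj2 (is_lim_seq_spec _ _) (tail_lim _ Hs)
        (mkposreal _ (ratio_pos N q Hp Hq))) as [r Hr].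
      exists r. intros _ q' Hq'. specialize (Hr q' Hq'). simpl in Hr.
      rewrite Rminus_0_r in Hr. apply Rlt_le, Rle_lt_trans with (2 := Hr), Rle_abs. }
    destruct HR as [r Hr].
    destruct (not_gamma1_large N Hp Hs Hg (INR i) (r + 2 * q + 1)) as (q' & H1 & _ & H2).
    exists q'. split; [lia|split; [exact H2|]].
    intros Hq. apply Hr; [exact Hq|lia]. }
  destruct (functional_choice _ Hnext) as [next Hn].
  exists (nat_rect _ q0 (fun i q => next (i, q))). simpl.
  split; [lia|]. split; [|split]; intros i; apply (Hn (i, _)).
Qed.

(** Membership of [b] would put every sequence dominated by [N] beyond [p0] into
    [Lambda M]; in particular the sequence equal to [N] at the doubles of
    lacunary indices and zero elsewhere would be a Borel image. By
    [gamma1_value_bound] the values in [gamma1] would then be bounded along the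
    indices where they were chosen unbounded. *)
Lemma large_not_in_Lambda N M b delta p0 :
  LC N -> nonquasianalytic N -> ~ gamma1 N -> pos_seq M ->
  Included _ (Lambda M) (Borel_image (Dspace N)) ->
  0 < delta -> (forall p, (p0 <= p)%nat -> delta * N p <= Cmod (b p)) ->
  ~ Lambda M b.
Proof.
  intros H Hs Hg HM Hinc Hd Hlarge (h & Hh & K & HK).
  pose proof (proj1 H) as Hp. change (ex_series (recip N)) in Hs.
  destruct (lacunary_indices N p0 Hp Hs Hg) as (s & Hs0 & Hstep & Hbad & Htail).
  assert (Hmono : forall i k, (i < k)%nat -> (2 * s i < s k)%nat).
  { intros i k Hik. induction Hik as [|k _ IH]; [apply Hstep|].
    specialize (Hstep k). lia. }
  set (a := fun p => if excluded_middle_informative (exists i, p = (2 * s i)%nat)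
                     then RtoC (N p) else RtoC 0).
  assert (Hon : forall i, a (2 * s i)%nat = RtoC (N (2 * s i)%nat)).
  { intros i. unfold a. destruct (excluded_middle_informative _) as [_|n]; [reflexivity|].
    exfalso. apply n. now exists i. }
  assert (Hoff : forall p, (forall i, p <> (2 * s i)%nat) -> a p = RtoC 0).
  { intros p Hne. unfold a.
    destruct (excluded_middle_informative _) as [[i Hi]|_]; [|reflexivity].
    now apply Hne in Hi. }
  assert (HaL : Lambda M a).
  { exists h. split; [exact Hh|]. exists (K / delta). intros p.
    assert (Hden : 0 < h ^ p * M p) by (apply Rmult_lt_0_compat; [now apply pow_lt|apply HM]).
    assert (Hle : delta * Cmod (a p) <= Cmod (b p)).
    { unfold a. destruct (excluded_middle_informative _) as [[i Hi]|_].
      - rewrite Cmod_R, Rabs_right by (apply Rle_ge, Rlt_le, Hp). apply Hlarge.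
        destruct i as [|i]; [lia|]. specialize (Hmono 0%nat (S i) ltac:(lia)). lia.
      - rewrite Cmod_0, Rmult_0_r. apply Cmod_ge_0. }
    apply Rmult_le_reg_l with delta; [exact Hd|].
    replace (delta * (K / delta)) with K by (field; lra).
    apply Rle_trans with (2 := HK p). unfold Rdiv. rewrite <- Rmult_assoc.
    apply Rmult_le_compat_r; [now apply Rlt_le, Rinv_0_lt_compat|exact Hle]. }
  apply Hinc, (Borel_image_chains N a Hp) in HaL.
  destruct HaL as (F & G & [[HF (n & C & Hn & HC & Hb)] _] & _ & Ha).
  assert (HFa : forall p, F p 0 = Re (a p)) by (intros p; now rewrite Ha).
  destruct (gamma1_value_bound N F n C H Hs HF Hn HC Hb) as [B HB].
  destruct (INR_unbounded B) as [i Hi].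
  assert (Hq1 : (1 <= s (S i))%nat) by (specialize (Hstep i); lia).
  pose proof (Hstep (S i)) as Hnext.
  specialize (HB (s (S i)) (s (S (S i))) Hq1 ltac:(lia)).
  assert (Hcon : tail (recip N) (s (S i) - 1) <= B * ratio N (s (S i))).
  { apply HB.
    - now rewrite HFa, Hon.
    - intros j Hj. rewrite HFa, Hoff; [reflexivity|]. intros k Hk.
      destruct (Nat.lt_trichotomy k (S i)) as [Hlt|[->|Hlt]]; [|lia|].
      + specialize (Hmono k (S i) Hlt). lia.
      + specialize (Hmono (S i) k Hlt). lia.
    - intros j Hj. rewrite HFa, Hoff; [reflexivity|]. intros k Hk.
      destruct (Nat.lt_trichotomy k (S i)) as [Hlt|[->|Hlt]]; [|lia|].
      + specialize (Hmono k (S i) Hlt). lia.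
      + destruct (Nat.eq_dec k (S (S i))) as [->|]; [lia|].
        specialize (Hmono (S (S i)) k ltac:(lia)). lia.
    - now apply Htail. }
  specialize (Hbad i). pose proof (ratio_pos N (s (S i)) Hp Hq1). nra.
Qed.

(** * Linear algebra of sequences *)

Lemma lincomb_O e c p : lincomb e c 0 p = Cmult (c 0%nat) (e 0%nat p).
Proof. unfold lincomb. now rewrite sum_O. Qed.

Lemma lincomb_S e c n p :
  lincomb e c (S n) p = Cplus (lincomb e c n p) (Cmult (c (S n)) (e (S n) p)).
Proof. unfold lincomb. now rewrite sum_Sn. Qed.

Lemma lincomb_ext e e' c c' n p q :
  (forall k, (k <= n)%nat -> Cmult (c k) (e k p) = Cmult (c' k) (e' k q)) ->
  lincomb e c n p = lincomb e' c' n q.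
Proof.
  induction n as [|n IH]; intros H.
  - rewrite !lincomb_O. now apply H.
  - rewrite !lincomb_S, H by lia. f_equal. apply IH. intros; apply H; lia.
Qed.

Lemma lincomb_zero e c n p :
  (forall k, (k <= n)%nat -> Cmult (c k) (e k p) = RtoC 0) -> lincomb e c n p = RtoC 0.
Proof.
  induction n as [|n IH]; intros H.
  - rewrite lincomb_O. now apply H.
  - rewrite lincomb_S, H, IH by (intros; try apply H; lia). ring.
Qed.

Lemma lincomb_plus e c c' n p :
  lincomb e (fun k => Cplus (c k) (c' k)) n p
    = Cplus (lincomb e c n p) (lincomb e c' n p).
Proof.
  induction n as [|n IH]; [rewrite !lincomb_O|rewrite !lincomb_S, IH]; ring.
Qed.

Lemma lincomb_scal e l c n p :
  lincomb e (fun k => Cmult l (c k)) n p = Cmult l (lincomb e c n p).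
Proof.
  induction n as [|n IH]; [rewrite !lincomb_O|rewrite !lincomb_S, IH]; ring.
Qed.

Lemma lincomb_pad e c n m : (n <= m)%nat -> forall p,
  lincomb e c n p = lincomb e (fun k => if le_dec k n then c k else RtoC 0) m p.
Proof.
  intros Hnm p. induction Hnm as [|m Hnm IH].
  - apply lincomb_ext. intros k Hk. now destruct (le_dec k n).
  - rewrite lincomb_S, <- IH. destruct (le_dec (S m) n); [lia|ring].
Qed.

Lemma lincomb_lincomb e A c n m p :
  lincomb (fun k => lincomb e (A k) n) c m p
    = lincomb e (fun i => lincomb A c m i) n p.
Proof.
  induction m as [|m IH].
  - rewrite lincomb_O, <- lincomb_scal. apply lincomb_ext.
    intros k _. now rewrite lincomb_O.
  - rewrite lincomb_S, IH, <- lincomb_scal, <- lincomb_plus. apply lincomb_ext.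
    intros k _. now rewrite lincomb_S.
Qed.

Lemma lincomb_in_subspace W e c n : subspace W ->
  (forall k, (k <= n)%nat -> W (e k)) -> W (lincomb e c n).
Proof.
  intros (_ & Hadd & Hscal) He. induction n as [|n IH].
  - replace (lincomb e c 0) with (fun p => Cmult (c 0%nat) (e 0%nat p)).
    + apply Hscal, He. lia.
    + apply functional_extensionality. intros p. now rewrite lincomb_O.
  - replace (lincomb e c (S n))
      with (fun p => Cplus (lincomb e c n p) (Cmult (c (S n)) (e (S n) p))).
    + apply Hadd; [apply IH; intros; apply He; lia|]. apply Hscal, He. lia.
    + apply functional_extensionality. intros p. now rewrite lincomb_S.
Qed.

Definition lin_span (e : nat -> nat -> C) : Ensemble (nat -> C) :=
  fun a => exists n c, a = lincomb e c n.

Lemma lin_span_generator e k : lin_span e (e k).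
Proof.
  exists k, (fun i => if Nat.eq_dec i k then RtoC 1 else RtoC 0).
  apply functional_extensionality. intros p. destruct k as [|k].
  - rewrite lincomb_O. simpl. ring.
  - rewrite lincomb_S, lincomb_zero.
    + destruct (Nat.eq_dec (S k) (S k)); [ring|easy].
    + intros i Hi. destruct (Nat.eq_dec i (S k)); [lia|ring].
Qed.

Lemma lin_span_subspace e : subspace (lin_span e).
Proof.
  split; [|split].
  - exists 0%nat, (fun _ => RtoC 0). apply functional_extensionality.
    intros p. rewrite lincomb_O. unfold zero_seq. ring.
  - intros a b (n & c & ->) (m & d & ->).
    exists (max n m), (fun k => Cplus (if le_dec k n then c k else RtoC 0)
                                      (if le_dec k m then d k else RtoC 0)).
    apply functional_extensionality. intros p.
    rewrite lincomb_plus, <- !lincomb_pad by lia. reflexivity.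
  - intros l a (n & c & ->). exists n, (fun k => Cmult l (c k)).
    apply functional_extensionality. intros p. now rewrite lincomb_scal.
Qed.

(** Gaussian elimination: an equation in which the last unknown occurs is used to
    eliminate that unknown from the others. *)
Lemma underdetermined_system n : forall A : nat -> nat -> C,
  exists c, (exists k, (k <= n)%nat /\ c k <> RtoC 0) /\
    forall i, (i < n)%nat -> lincomb A c n i = RtoC 0.
Proof.
  induction n as [|n IH]; intros A.
  - exists (fun _ => RtoC 1). split; [|lia].
    exists 0%nat. split; [lia|]. intros E. injection E. lra.
  - destruct (classic (exists i, (i < S n)%nat /\ A (S n) i <> RtoC 0))
      as [(i0 & Hi0 & HA)|Hno].
    + set (skip := fun i => if lt_dec i i0 then i else S i).
      set (r := fun k => Cdiv (A k i0) (A (S n) i0)).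
      destruct (IH (fun k i => Cminus (A k (skip i)) (Cmult (r k) (A (S n) (skip i)))))
        as (c & (k & Hk & Hck) & Hc).
      set (last := Copp (lincomb (fun k _ => r k) c n 0)).
      exists (fun k => if le_dec k n then c k else last). split.
      * exists k. split; [lia|]. now destruct (le_dec k n).
      * assert (E : forall i, lincomb A (fun k => if le_dec k n then c k else last) (S n) i
           = lincomb (fun k i => Cminus (A k i) (Cmult (r k) (A (S n) i))) c n i).
        { intros i. rewrite lincomb_S, (lincomb_ext A A _ c n i i)
            by (intros j Hj; destruct (le_dec j n); [reflexivity|lia]).
          destruct (le_dec (S n) n) as [|_]; [lia|]. unfold last. clear.
          clearbody r.
          generalize (A (S n)). intros z.
          induction n as [|n IH]; [rewrite !lincomb_O|rewrite !lincomb_S, <- IH];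
            cbv beta; ring. }
        intros i Hi. rewrite E.
        destruct (Nat.eq_dec i i0) as [->|Hne].
        -- apply lincomb_zero. intros j _. unfold r. field. exact HA.
        -- set (i' := if lt_dec i i0 then i else (i - 1)%nat).
           assert (Hi' : skip i' = i).
           { unfold skip, i'. destruct (lt_dec i i0).
             - destruct (lt_dec i i0); lia.
             - destruct (lt_dec (i - 1) i0); lia. }
           rewrite <- (Hc i') by (unfold i'; destruct (lt_dec i i0); lia).
           apply lincomb_ext. intros j _. now rewrite Hi'.
    + exists (fun k => if le_dec k n then RtoC 0 else RtoC 1). split.
      * exists (S n). split; [lia|]. destruct (le_dec (S n) n); [lia|].
        intros E. injection E. lra.
      * intros i Hi. apply lincomb_zero. intros k Hk.
        destruct (le_dec k n); [ring|]. replace k with (S n) by lia.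
        destruct (classic (A (S n) i = RtoC 0)) as [E|E]; [rewrite E; ring|].
        exfalso. apply Hno. now exists i.
Qed.

(** Expanding [n + 2] members of the basis in [n + 1] generators gives an
    underdetermined system, hence a linear relation. *)
Lemma dim_aleph0_not_finite_dim W : dim_aleph0 W -> ~ finite_dim W.
Proof.
  intros (e & HeW & Hfree & _) (n & e' & _ & Hgen).
  destruct (functional_choice (fun k c => e k = lincomb e' c n)
    (fun k => Hgen (e k) (HeW k))) as [A HA].
  destruct (underdetermined_system (S n) A) as (c & (k & Hk & Hck) & Hc).
  apply Hck, (Hfree (S n) c); [|exact Hk].
  apply functional_extensionality. intros p.
  replace (lincomb e c (S n) p)
    with (lincomb (fun k => lincomb e' (A k) n) c (S n) p)
    by (apply lincomb_ext; intros j _; now rewrite HA).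
  rewrite lincomb_lincomb. apply lincomb_zero.
  intros i Hi. rewrite Hc by lia. ring.
Qed.

(** * The span of the dilates *)

(** The Borel image of the dilate [x => F ((k + 1) x)], when [f] is that of [F]. *)
Definition dilates (f : nat -> R) (k p : nat) : C := RtoC (INR (S k) ^ p * f p).

Lemma dilates_Cmod f k p : Cmod (dilates f k p) = INR (S k) ^ p * Rabs (f p).
Proof.
  unfold dilates. rewrite Cmod_R, Rabs_mult. f_equal.
  apply Rabs_right, Rle_ge, pow_le, pos_INR.
Qed.

Lemma dilates_upper f c n : exists B, 0 <= B /\
  forall p, Cmod (lincomb (dilates f) c n p) <= B * (INR (S n) ^ p * Rabs (f p)).
Proof.
  induction n as [|n (B & HB & H)].
  - exists (Cmod (c 0%nat)). split; [apply Cmod_ge_0|]. intros p.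
    rewrite lincomb_O, Cmod_mult, dilates_Cmod. lra.
  - exists (B + Cmod (c (S n))). pose proof (Cmod_ge_0 (c (S n))).
    split; [lra|]. intros p.
    rewrite lincomb_S. apply Rle_trans with (1 := Cmod_triangle _ _).
    rewrite Cmod_mult, dilates_Cmod, Rmult_plus_distr_r.
    apply Rplus_le_compat_r. apply Rle_trans with (1 := H p).
    apply Rmult_le_compat_l; [exact HB|].
    apply Rmult_le_compat_r; [apply Rabs_pos|].
    apply pow_incr. split; [apply pos_INR|apply le_INR; lia].
Qed.

(** The dilates grow at different geometric rates, so the one of highest index
    with a nonzero coefficient dominates and nothing cancels it. *)
Lemma dilates_lower f c n : (exists k, (k <= n)%nat /\ c k <> RtoC 0) ->
  exists delta p0, 0 < delta /\ forall p, (p0 <= p)%nat ->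
    delta * Rabs (f p) <= Cmod (lincomb (dilates f) c n p).
Proof.
  induction n as [|n IH]; intros (k & Hk & Hck).
  - replace k with 0%nat in Hck by lia.
    exists (Cmod (c 0%nat)), 0%nat. split; [now apply Cmod_gt_0|]. intros p _.
    rewrite lincomb_O, Cmod_mult, dilates_Cmod.
    simpl INR. rewrite pow1, Rmult_1_l. lra.
  - destruct (Ceq_dec (c (S n)) (RtoC 0)) as [E|E].
    + destruct IH as (delta & p0 & Hd & H).
      { exists k. split; [|exact Hck]. destruct (Nat.eq_dec k (S n)) as [->|]; [easy|lia]. }
      exists delta, p0. split; [exact Hd|]. intros p Hp.
      rewrite lincomb_S, E. replace (Cplus _ _) with (lincomb (dilates f) c n p) by ring.
      now apply H.
    + destruct (dilates_upper f c n) as (B & HB & Hup).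
      set (d := Cmod (c (S n))). assert (Hd : 0 < d) by now apply Cmod_gt_0.
      set (x := INR (S n)). set (y := INR (S (S n))).
      assert (Hx : 0 <= x) by apply pos_INR.
      assert (Hy : 1 <= y) by (apply (le_INR 1); lia).
      assert (Hxy : y = x + 1) by apply S_INR.
      destruct (pow_lt_1_zero (x / y)) with (y := d / (2 * (B + 1))) as [p0 H0].
      * rewrite Rabs_right.
        -- apply Rmult_lt_reg_r with y; [lra|]. unfold Rdiv.
           rewrite Rmult_assoc, Rinv_l; lra.
        -- apply Rle_ge, Rmult_le_pos; [exact Hx|apply Rlt_le, Rinv_0_lt_compat; lra].
      * apply Rdiv_lt_0_compat; lra.
      * exists (d / 2), p0. split; [lra|]. intros p Hp.
        specialize (H0 p Hp). specialize (Hup p).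
        pose proof (Rabs_pos (f p)) as Hf.
        pose proof (pow_R1_Rle y p Hy) as Hyp.
        assert (Hsmall : B * x ^ p <= d / 2 * y ^ p).
        { assert (Hq : (x / y) ^ p * y ^ p = x ^ p).
          { rewrite <- Rpow_mult_distr. f_equal. field. lra. }
          rewrite <- Hq, <- Rmult_assoc. apply Rmult_le_compat_r; [lra|].
          apply Rle_trans with (B * (d / (2 * (B + 1)))).
          - apply Rmult_le_compat_l; [exact HB|].
            apply Rlt_le, Rle_lt_trans with (2 := H0), Rle_abs.
          - apply Rmult_le_reg_r with (2 * (B + 1)); [lra|].
            unfold Rdiv. rewrite 2!Rmult_assoc, Rinv_l by lra. nra. }
        rewrite lincomb_S.
        assert (T : Cmod (Cmult (c (S n)) (dilates f (S n) p))
          <= Cmod (Cplus (lincomb (dilates f) c n p) (Cmult (c (S n)) (dilates f (S n) p)))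
             + Cmod (lincomb (dilates f) c n p)).
        { set (u := Cmult _ _). set (v := lincomb _ _ _ _).
          rewrite <- (Cmod_opp v).
          replace u with (Cplus (Cplus v u) (Copp v)) at 1 by ring.
          apply Cmod_triangle. }
        rewrite Cmod_mult, dilates_Cmod in T at 1. fold d y in T.
        fold x in Hup.
        assert (B * (x ^ p * Rabs (f p)) <= d / 2 * y ^ p * Rabs (f p)).
        { rewrite <- Rmult_assoc. apply Rmult_le_compat_r; assumption. }
        assert (d / 2 * Rabs (f p) <= d / 2 * y ^ p * Rabs (f p)).
        { rewrite Rmult_assoc. apply Rmult_le_compat_l; [lra|]. nra. }
        lra.
Qed.

Theorem proposition5p4 (N : nat -> R) (hLC : LC N)
  (hnq : nonquasianalytic N) (hg : ~ gamma1 N) :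
  let V := Borel_image (Dspace N) in
  let L := Setminus _ V (fun a => exists M, calM N M /\ Lambda M a) in
  (forall M, calM N M -> Strict_Included _ (Lambda M) V) /\
  lineable_in V L /\
  (exists W, subspace W /\ dim_aleph0 W /\
             Included _ W (Union _ L (Singleton _ zero_seq))).
Proof.
  intros V L. pose proof (proj1 hLC) as Hp.
  destruct (large_compact N hLC hnq) as (F & HFc & HFs & HF).
  set (e := dilates (fun p => F p 0)).
  assert (HV : subspace V) by now apply Borel_image_subspace.
  assert (HeV : forall k, V (e k)).
  { intros k. apply Borel_image_chains; [exact Hp|].
    exists (fun p x => INR (S k) ^ p * F p (INR (S k) * x)), (fun _ _ => 0).
    split; [|split].
    - apply compact_chain_dilate; [exact Hp|apply (le_INR 1); lia|now split].
    - now apply compact_chain_zero.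
    - intros p. now rewrite Rmult_0_r. }
  assert (Hlarge : forall n c, (exists k, (k <= n)%nat /\ c k <> RtoC 0) ->
    exists delta p0, 0 < delta /\ forall p, (p0 <= p)%nat ->
      delta * N p <= Cmod (lincomb e c n p)).
  { intros n c Hc. destruct (dilates_lower (fun p => F p 0) c n Hc)
      as (delta & p0 & Hd & H).
    exists (delta / 2), p0. split; [lra|]. intros p Hpp.
    apply Rle_trans with (2 := H p Hpp). specialize (HF p).
    replace (delta / 2 * N p) with (delta * (N p / 2)) by field.
    apply Rmult_le_compat_l; lra. }
  assert (Hout : forall n c, (exists k, (k <= n)%nat /\ c k <> RtoC 0) ->
    forall M, calM N M -> ~ Lambda M (lincomb e c n)).
  { intros n c Hc M [[HM _] Hinc].
    destruct (Hlarge n c Hc) as (delta & p0 & Hd & H).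
    now apply (large_not_in_Lambda N M _ delta p0). }
  assert (Hincl : Included _ (lin_span e) (Union _ L (Singleton _ zero_seq))).
  { intros a (n & c & ->).
    destruct (classic (exists k, (k <= n)%nat /\ c k <> RtoC 0)) as [Hc|Hc].
    - left. split.
      + apply lincomb_in_subspace; [exact HV|]. intros; apply HeV.
      + intros (M & HM & HL). now apply (Hout n c Hc M HM).
    - right. replace (lincomb e c n) with zero_seq; [constructor|].
      apply functional_extensionality. intros p. symmetry.
      apply lincomb_zero. intros k Hk.
      destruct (Ceq_dec (c k) (RtoC 0)) as [E|E]; [rewrite E; ring|].
      exfalso. apply Hc. now exists k. }
  assert (Hdim : dim_aleph0 (lin_span e)).
  { exists e. split; [|split].
    - apply lin_span_generator.
    - intros n c Hz k Hk. apply NNPP. intros Hck.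
      destruct (Hlarge n c (ex_intro _ k (conj Hk Hck))) as (delta & p0 & Hd & H).
      specialize (H p0 (le_n _)). rewrite Hz in H. unfold zero_seq in H.
      rewrite Cmod_0 in H. specialize (Hp p0). nra.
    - intros a Ha. exact Ha. }
  split; [|split].
  - intros M HM. split; [exact (proj2 HM)|]. intros E.
    apply (Hout 0%nat (fun _ => RtoC 1)) with (2 := HM).
    + exists 0%nat. split; [lia|]. intros E1. injection E1. lra.
    + rewrite E. apply lincomb_in_subspace; [exact HV|]. intros; apply HeV.
  - split; [exact HV|split; [intros a [Ha _]; exact Ha|]].
    exists (lin_span e). split; [apply lin_span_subspace|split; [|exact Hincl]].
    now apply dim_aleph0_not_finite_dim.
  - exists (lin_span e). split; [apply lin_span_subspace|split; [exact Hdim|exact Hincl]].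
Qed.
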